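(* Let $m,n$ be coprime positive integers and let $\mathcal X_3$ be the $\mathrm{SL}(3,\mathbb C)$-character variety of the torus knot $K_{m,n}$, with irreducible locus $\mathcal X_3^*$. Let $X_{PR}$ be a component of the partially reducible locus (of type 1 or type 2), determined by the eigenvalues $\{\epsilon,1/\epsilon\}$ and $\{\varepsilon,1/\varepsilon\}$, with coordinate $z\in\mathbb C^*$ as in the context, and let $$\Delta_{\epsilon,\varepsilon}(t)=\frac{(t^{mn}-\epsilon^n)^2}{(t^m-\epsilon)(t^m-1/\epsilon)(t^n-\varepsilon)(t^n-1/\varepsilon)} .$$ Then $X_{PR}$ intersects the closure of $\mathcal X_3^*$ precisely at the curves $\{z=z_0\}$ with $\Delta_{\epsilon,\varepsilon}(z_0^3)=0$. In addition, such a curve $\{z=z_0\}$ lies in the closure of a four-dimensional component of $\mathcal X_3^*$ if $z_0^3$ is a root of multiplicity two of $\Delta_{\epsilon,\varepsilon}$, and in the closure of a two-dimensional component of $\mathcal X_3^*$ if $z_0^3$ is a simple root.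
   Context: The knot group is $\Gamma=\langle x,y\mid x^n=y^m\rangle$; $\mathcal X_r$ is the affine GIT quotient by conjugation of the set of pairs $(A,B)\in\mathrm{SL}(r,\mathbb C)^2$ with $A^n=B^m$; its points are classes of semisimple representations and $\mathcal X_r^*$ is the irreducible locus. Each component $Y$ of $\mathcal X_2^*$ is isomorphic to $\mathbb C-\{0,1\}$ and is determined by the eigenvalues $\{\epsilon,1/\epsilon\}$ of $A$ and $\{\varepsilon,1/\varepsilon\}$ of $B$ (with $\epsilon^n=\varepsilon^m=\pm1$, $\epsilon,\varepsilon\neq\pm1$). A partially reducible point of $\mathcal X_3$ is a sum $V\oplus W$ with $V$ irreducible of dimension $2$ and $W=(\det V)^{-1}$ one-dimensional. The components of the partially reducible locus are the images of the maps $$Y\times\mathbb C^*\to\mathcal X_3,\qquad ((A,B),z)\mapsto (z^mA,z^nB)\oplus(z^{-2m},z^{-2n}).$$ Let $-1\in\mu_2$ act on $\mathcal X_2^*$ by $(A,B)\mapsto((-1)^mA,(-1)^nB)$. If $Y$ is not preserved by $-1$, the component is of type 1 and is isomorphic to $Y\times\mathbb C^*\cong(\mathbb C-\{0,1\})\times\mathbb C^*$; if $Y$ is preserved, it is of type 2 and isomorphic to $(Y\times\mathbb C^* )/\mu_2$, with $-1$ acting also by $z\mapsto-z$. The coordinate $z$ is that of the factor $\mathbb C^*$ and the curve $\{z=z_0\}$ is the image of $Y\times\{z_0\}$. The function $\Delta_{\epsilon,\varepsilon}$ is the twisted Alexander polynomial of the corresponding irreducible representations in $\mathrm{SL}(2,\mathbb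 C)$ (a polynomial in $t$). The components of $\mathcal X_3^*$ have dimension $4$ or $2$. *)

(* Defs.v *)
From HB Require Import structures.
From mathcomp Require Import all_boot all_order all_algebra.
From mathcomp Require Import mpoly complex classical_sets reals.

Set Implicit Arguments.
Unset Strict Implicit.
Unset Printing Implicit Defensive.

Import GRing.Theory.
Local Open Scope classical_set_scope.
Local Open Scope ring_scope.

Section CharacterVariety.
Variables (F : fieldType) (m n r : nat).

Definition mxpair : Type := 'M[F]_r * 'M[F]_r.

(* Representations of <x, y | x ^ n = y ^ m> in SL(r, F), as the pairs
   (A, B) = (image of x, image of y). *)
Definition rep_variety : set mxpair :=
  [set AB | [/\ \det AB.1 = 1, \det AB.2 = 1 & AB.1 ^+ n = AB.2 ^+ m]].

Definition conj_pair (g : 'M[F]_r) (AB : mxpair) : mxpair :=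
  (g *m AB.1 *m invmx g, g *m AB.2 *m invmx g).

(* Over an algebraically closed field, conjugation by GL(r) and by SL(r) have
   the same orbits, as the scalar matrices act trivially. *)
Definition conj_orbit (AB : mxpair) : set mxpair :=
  [set CD | exists2 g, g \in unitmx & CD = conj_pair g AB].

(* Matrices act on row vectors on the right, and a subspace of F ^ r is the row
   space of an r x r matrix U.  This is the action of the transposed pair on
   column vectors; transposition affects neither irreducibility nor
   semisimplicity. *)
Definition invariant_subspace (AB : mxpair) (U : 'M[F]_r) : Prop :=
  stablemx U AB.1 /\ stablemx U AB.2.

Definition irreducible_rep (AB : mxpair) : Prop :=
  (0 < r)%N /\
  forall U, invariant_subspace AB U -> \rank U = 0%N \/ \rank U = r.

Definition semisimple_rep (AB : mxpair) : Prop :=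
  forall U, invariant_subspace AB U ->
    exists W, [/\ invariant_subspace AB W,
                  (U + W :=: 1%:M)%MS & (U :&: W = 0)%MS].

(* A point of the GIT quotient is a conjugacy class of semisimple
   representations (a closed orbit). *)
Definition char_variety : set (set mxpair) :=
  [set O | exists AB, [/\ rep_variety AB, semisimple_rep AB
                        & O = conj_orbit AB]].

Definition irr_locus : set (set mxpair) :=
  [set O | exists AB, [/\ rep_variety AB, irreducible_rep AB
                        & O = conj_orbit AB]].

(* Regular functions on pairs of matrices: polynomials in the 2 r ^ 2 entries. *)
Definition regfun : Type := {mpoly F[r * r + r * r]}.

Definition reg_eval (f : regfun) (AB : mxpair) : F :=
  f.@[fun k => row_mx (mxvec AB.1) (mxvec AB.2) 0 k].

(* f restricts to an element of the ring of invariants of the coordinate ring of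
   the representation variety, that is, to a regular function on the GIT
   quotient. *)
Definition invariant_fun (f : regfun) : Prop :=
  forall AB g, rep_variety AB -> g \in unitmx ->
    reg_eval f (conj_pair g AB) = reg_eval f AB.

Definition vanishes_at (f : regfun) (O : set mxpair) : Prop :=
  forall AB, O AB -> reg_eval f AB = 0.

(* Zariski topology of the GIT quotient. *)
Definition zero_locus (I : set regfun) : set (set mxpair) :=
  [set O | char_variety O /\ forall f, I f -> vanishes_at f O].

Definition zclosed (Z : set (set mxpair)) : Prop :=
  exists2 I : set regfun, I `<=` invariant_fun & Z = zero_locus I.

Definition zclosure (S : set (set mxpair)) : set (set mxpair) :=
  smallest zclosed S.

Definition zirreducible (S : set (set mxpair)) : Prop :=
  S !=set0 /\
  forall Z1 Z2, zclosed Z1 -> zclosed Z2 ->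
    S `<=` Z1 `|` Z2 -> S `<=` Z1 \/ S `<=` Z2.

Definition irr_component (T S : set (set mxpair)) : Prop :=
  [/\ S `<=` T, zirreducible S &
      forall S', S' `<=` T -> zirreducible S' -> S `<=` S' -> S' = S].

Definition alg_indep_on (S : set (set mxpair)) (d : nat) (f : 'I_d -> regfun) :
    Prop :=
  forall P : {mpoly F[d]},
    (forall O AB, S O -> O AB -> P.@[fun i => reg_eval (f i) AB] = 0) -> P = 0.

(* The dimension of an irreducible S is the transcendence degree of its function
   field, which is attained by regular functions since they generate it. *)
Definition has_dim (S : set (set mxpair)) (d : nat) : Prop :=
  (exists f : 'I_d -> regfun,
     (forall i, invariant_fun (f i)) /\ alg_indep_on S f) /\
  (forall f : 'I_d.+1 -> regfun,
     (forall i, invariant_fun (f i)) -> ~ alg_indep_on S f).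

End CharacterVariety.

Arguments rep_variety F m n r : clear implicits.
Arguments char_variety F m n r : clear implicits.
Arguments irr_locus F m n r : clear implicits.

Section PartiallyReducible.
Variables (F : fieldType) (m n : nat).

(* (z ^ m A, z ^ n B) (+) (z ^ (- 2 m), z ^ (- 2 n)) *)
Definition pr_rep (AB : mxpair F 2) (z : F) : mxpair F 3 :=
  (block_mx (z ^+ m *: AB.1) 0 0 ((z ^- (2 * m))%:M : 'M_1) : 'M_(2 + 1),
   block_mx (z ^+ n *: AB.2) 0 0 ((z ^- (2 * n))%:M : 'M_1) : 'M_(2 + 1)).

Definition pr_curve (Y : set (set (mxpair F 2))) (z : F) :
    set (set (mxpair F 3)) :=
  [set O | exists P AB, [/\ Y P, P AB & O = conj_orbit (pr_rep AB z)]].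

Definition pr_component (Y : set (set (mxpair F 2))) : set (set (mxpair F 3)) :=
  \bigcup_(z in [set z : F | z != 0]) pr_curve Y z.

(* The division is exact when eps ^ n = veps ^ m = 1 or -1, m and n are coprime
   and eps, veps are not 1 or -1. *)
Definition twisted_alexander (eps veps : F) : {poly F} :=
  ('X^(m * n) - (eps ^+ n)%:P) ^+ 2 %/
  (('X^m - eps%:P) * ('X^m - (eps^-1)%:P) *
   ('X^n - veps%:P) * ('X^n - (veps^-1)%:P)).

End PartiallyReducible.

(* Main.v *)
Require Import Defs.
From HB Require Import structures.
From mathcomp Require Import all_boot all_order all_algebra.
From mathcomp Require Import mpoly complex classical_sets reals.
From mathcomp Require Import perm spectral boolp ring.

(** If (A, B) is an irreducible representation of rank 3, then A ^ n = B ^ m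
commutes with A and B, so that it is a scalar omega with omega ^ 3 = 1
([irreducible_scalar], [irreducible_rep_eigenvalues]).  Hence A and B are
diagonalizable and their characteristic polynomials take finitely many values.
Moreover A and B cannot both have a repeated eigenvalue, as two eigenspaces of
dimension 2 in a space of dimension 3 share an eigenvector
([repeated_eigenvalues_reducible]).

For rows lam and mu of eigenvalues, the irreducible representations with these
eigenvalues are the conjugates of the pairs (D_lam, h D_mu h^-1), where h is
invertible; let S be the set of their classes ([stratum]).  A polynomial function
of such a pair is, as a function of h, a polynomial divided by a power of det h.
So a product of two of them vanishes identically only if a factor does, and one
that vanishes for h in general position vanishes for all h.  This makes S Zariski
irreducible, and puts every semisimple class of the form (D_lam, h D_mu h^-1),
reducible or not, in the closure of S ([stratum_closure]).  An irreducible subset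
of the irreducible locus that contains S has constant characteristic polynomials,
since these take finitely many values; so S is a component ([stratum_component]).

The dimension of S is the number of parameters that are left after conjugation.
If all eigenvalues are distinct, then h can be rescaled on both sides until its
first row and its first column consist of 1, and 4 parameters are left.  If B has
a repeated eigenvalue, then B is determined by a projection of rank one, which can
be conjugated to p (1, 1, 1) for a column p with entries of sum 1; 2 parameters are
left, and exchanging A and B deals with a repeated eigenvalue of A.  Any d + 1
invariants are rational functions of the d parameters, hence algebraically
dependent ([regular_dependence]); conversely d of the traces of the products of
a spectral projection of A and one of B take generic values on S independently
([prescribed_projector_traces], [barycentric_mx_vertex]).

Now let V (+) W be the representation with parameter z, and t = z ^ 3.  The
eigenvalues of the image of x are w eps, w / eps and w ^ -2 with w = z ^ m.  Their
n-th powers agree if and only if t ^ (m n) = eps ^ n, and two of the eigenvalues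
agree if and only if t ^ m is eps or 1 / eps; similarly for the image of y.  On
the other side the numerator of Delta has double roots at the t with
t ^ (m n) = eps ^ n, and the denominator cancels a simple root for each of the
two generators that has a repeated eigenvalue ([mup_twisted_alexander]).  So
Delta(t) = 0 means exactly that the pair has the eigenvalues of some irreducible
representation: this is necessary in the closure, where the characteristic
polynomials are those of an irreducible representation
([zclosure_irr_locus_det_sub], [closure_root]), and it is sufficient by the above.
A double root means that no eigenvalue is repeated, which gives a component of
dimension 4, and a simple root that exactly one generator has a repeated
eigenvalue, which gives a component of dimension 2 ([component_closure]). *)

Set Implicit Arguments.
Unset Strict Implicit.
Unset Printing Implicit Defensive.

Import GRing.Theory.
Local Open Scope classical_set_scope.
Local Open Scope ring_scope.

(** * Functions with polynomial numerators on a principal open set *)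

Section PolynomialFunctions.
Variable F : numFieldType.

Lemma poly_nonroot (p : {poly F}) : p != 0 -> exists x, p.[x] != 0.
Proof.
move=> p0; pose s := [seq (i%:R : F) | i <- iota 0 (size p)].
have us : uniq s.
  rewrite map_inj_uniq ?iota_uniq // => i j /eqP.
  by rewrite Num.Theory.eqr_nat => /eqP.
have [|/allPn[x _ nx]] := boolP (all (root p) s); last by exists x.
by move=> /(max_poly_roots p0)/(_ us); rewrite size_map size_iota ltnn.
Qed.

(** The coefficient of a monomial in p is a coefficient of a coefficient of [muni p]. *)
Lemma muni_eq0 d (p : {mpoly F[d.+1]}) : muni p = 0 -> p = 0.
Proof.
move=> p0; apply/mpolyP => k.
pose k' : 'X_{1..d} := [multinom k (widen_ord (leqnSn d) i) | i < d].
suff <- : ((muni p)`_(k ord_max))@_k' = p@_k by rewrite p0 coef0 !mcoeff0.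
rewrite muniE coef_sum raddf_sum /=.
rewrite [in RHS](mpolyE p) raddf_sum /=; apply: eq_bigr => m _.
rewrite coefZ coefXn mulr_natr mcoeffZ mcoeffX mcoeffMn mcoeffZ mcoeffX.
rewrite -mulrnAr; congr (_ * _); rewrite -mulr_natr -natrM mulnb.
congr ((nat_of_bool _)%:R); apply/andP/eqP => [[/eqP e1 /eqP e2]|->]; last first.
  by rewrite !eqxx.
apply/mnmP => i; have [lt_id|] := ltnP i d; last first.
  move=> le_di; suff -> : i = ord_max by [].
  by apply/val_inj/eqP; rewrite eqn_leq le_di -ltnS ltn_ord.
move/mnmP/(_ (Ordinal lt_id)): e1; rewrite !mnmE.
by congr (m _ = k _); apply: val_inj.
Qed.

Lemma meval_muni d (p : {mpoly F[d.+1]}) (x : 'I_d.+1 -> F) :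
  p.@[x] = (map_poly (meval (x \o widen_ord (leqnSn d))) (muni p)).[x ord_max].
Proof.
rewrite muniE rmorph_sum horner_sum /= mevalE.
apply: eq_bigr => m _; rewrite -mul_polyC rmorphM /= map_polyC map_polyXn hornerM.
rewrite hornerC hornerXn /= mevalZ mevalX -mulrA; congr (_ * _).
by rewrite big_ord_recr /=; congr (_ * _); apply: eq_bigr => i _; rewrite mnmE.
Qed.

(** Induction on the number of variables: a point where the leading coefficient
in the last variable does not vanish leaves a nonzero polynomial in one
variable. *)
Lemma mpoly_nonroot d (p : {mpoly F[d]}) : p != 0 -> exists x, p.@[x] != 0.
Proof.
elim: d p => [|d IHd] p p0.
  exists (fun=> 0); apply: contra p0 => /eqP pe; apply/eqP/mpolyP => k.
  rewrite mcoeff0 -pe mevalE [in LHS](mpolyE p) raddf_sum /=.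
  apply: eq_bigr => m _; rewrite mcoeffZ mcoeffX big_ord0.
  by have -> : m = k; [apply/mnmP => -[] | rewrite eqxx].
have: muni p != 0 by apply: contra p0 => /eqP/muni_eq0 ->.
rewrite -lead_coef_eq0 => /IHd[y ly].
have: map_poly (meval y) (muni p) != 0.
  by apply: contra ly => /eqP/polyP/(_ (size (muni p)).-1); rewrite coef_map coef0 => <-.
move=> /poly_nonroot[z pz].
exists (fun i => if unlift ord_max i is Some j then y j else z).
rewrite meval_muni unlift_none; congr (_.[z] != 0): pz.
apply: eq_map_poly => q; apply: meval_eq => i /=.
suff -> : widen_ord (leqnSn d) i = lift ord_max i by rewrite liftK.
by apply: val_inj; rewrite /= /bump leqNgt ltn_ord.
Qed.

Lemma mpoly_eq0P d (p : {mpoly F[d]}) : (forall x, p.@[x] = 0) -> p = 0.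
Proof.
by move=> pe; apply/eqP/contraT => /mpoly_nonroot[x]; rewrite pe eqxx.
Qed.

(** Membership of g in the localization of the polynomial ring at q, as a function
on the open set where q does not vanish; the values of g elsewhere are
irrelevant. *)
Definition regular_on d (q : {mpoly F[d]}) (g : ('I_d -> F) -> F) :=
  exists k (p : {mpoly F[d]}), forall x, q.@[x] != 0 -> g x * q.@[x] ^+ k = p.@[x].

Section RegularOn.
Variables (d : nat) (q : {mpoly F[d]}).
Local Notation regular := (regular_on q).

Lemma regular_eq f g : (forall x, q.@[x] != 0 -> f x = g x) ->
  regular g -> regular f.
Proof. by move=> fg [k [p gp]]; exists k, p => x qx; rewrite fg ?gp. Qed.

Lemma regular_poly p : regular (fun x => p.@[x]).
Proof. by exists 0, p => x _; rewrite mulr1. Qed.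

Lemma regular_const c : regular (fun=> c).
Proof. by apply: regular_eq (regular_poly c%:MP) => x _; rewrite mevalC. Qed.

Lemma regular_add f g : regular f -> regular g -> regular (fun x => f x + g x).
Proof.
move=> [k [p fp]] [l [r gr]]; exists (k + l)%N, (p * q ^+ l + r * q ^+ k) => x qx.
rewrite mevalD !mevalM !rmorphXn /= -fp // -gr // mulrDl exprD !mulrA; congr (_ + _).
by rewrite mulrAC.
Qed.

Lemma regular_mul f g : regular f -> regular g -> regular (fun x => f x * g x).
Proof.
move=> [k [p fp]] [l [r gr]]; exists (k + l)%N, (p * r) => x qx.
by rewrite rmorphM /= -fp // -gr // exprD mulrACA.
Qed.

Lemma regular_inv : regular (fun x => q.@[x]^-1).
Proof. by exists 1, 1 => x qx; rewrite rmorph1 expr1 mulVf. Qed.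

Lemma regular_sum I (r : seq I) (f : I -> ('I_d -> F) -> F) :
  (forall i, regular (f i)) -> regular (fun x => \sum_(i <- r) f i x).
Proof.
move=> rf; elim: r => [|i r IH].
  by apply: regular_eq (regular_const 0) => x _; rewrite big_nil.
by apply: regular_eq (regular_add (rf i) IH) => x _; rewrite big_cons.
Qed.

Lemma regular_prod I (r : seq I) (f : I -> ('I_d -> F) -> F) :
  (forall i, regular (f i)) -> regular (fun x => \prod_(i <- r) f i x).
Proof.
move=> rf; elim: r => [|i r IH].
  by apply: regular_eq (regular_const 1) => x _; rewrite big_nil.
by apply: regular_eq (regular_mul (rf i) IH) => x _; rewrite big_cons.
Qed.

Lemma regular_meval e (p : {mpoly F[e]}) (f : 'I_e -> ('I_d -> F) -> F) :
  (forall i, regular (f i)) -> regular (fun x => p.@[fun i => f i x]).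
Proof.
move=> rf; have rX i k : regular (fun x => f i x ^+ k).
  elim: k => [|k IH]; first exact: regular_const 1.
  by apply: regular_eq (regular_mul (rf i) IH) => x _; rewrite exprS.
apply: (@regular_eq _ (fun x => \sum_(m <- msupp p) p@_m * \prod_i f i x ^+ m i)).
  by move=> x _; exact: mevalE.
by apply: regular_sum => m; apply/regular_mul/regular_prod => //; exact: regular_const.
Qed.

(** The localization of the polynomial ring is an integral domain. *)
Lemma regular_eq0 f g : q != 0 -> regular f -> regular g ->
  (forall x, q.@[x] != 0 -> f x * g x = 0) ->
  (forall x, q.@[x] != 0 -> f x = 0) \/ (forall x, q.@[x] != 0 -> g x = 0).
Proof.
move=> q0 [k [p fp]] [l [r gr]] fg0.
have : p * r * q = 0.
  apply: mpoly_eq0P => x; rewrite !rmorphM /=.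
  have [->|qx] := eqVneq q.@[x] 0; first by rewrite mulr0.
  by rewrite -fp // -gr // mulrACA fg0 // !mul0r.
move/eqP; rewrite !mulf_eq0 (negPf q0) orbF => /orP[] /eqP e0; [left|right] => x qx.
  by move/eqP: (fp x qx); rewrite e0 meval0 mulf_eq0 expf_eq0 (negPf qx) andbF orbF => /eqP.
by move/eqP: (gr x qx); rewrite e0 meval0 mulf_eq0 expf_eq0 (negPf qx) andbF orbF => /eqP.
Qed.

Lemma regular_density (r : {mpoly F[d]}) f : q != 0 -> r != 0 -> regular f ->
  (forall x, q.@[x] != 0 -> r.@[x] != 0 -> f x = 0) ->
  forall x, q.@[x] != 0 -> f x = 0.
Proof.
move=> q0 r0 rf fr0.
have frq x : q.@[x] != 0 -> f x * r.@[x] = 0.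
  by move=> qx; have [->|rx] := eqVneq r.@[x] 0; rewrite ?mulr0 // fr0 ?mul0r.
have [//|rq0] := regular_eq0 q0 rf (regular_poly r) frq.
case/negP: (mulf_neq0 q0 r0); apply/eqP/mpoly_eq0P => x.
rewrite rmorphM /=; have [->|qx] := eqVneq q.@[x] 0; first by rewrite mul0r.
by rewrite rq0 ?mulr0.
Qed.

End RegularOn.

Definition degree_le d k (p : {mpoly F[d]}) := (msize p <= k.+1)%N.

Lemma degree_leM d k l (p q : {mpoly F[d]}) :
  degree_le k p -> degree_le l q -> degree_le (k + l) (p * q).
Proof.
rewrite /degree_le; have [->|p0] := eqVneq p 0; first by rewrite mul0r msize0.
have [->|q0] := eqVneq q 0; first by rewrite mulr0 msize0.
move=> pk ql; rewrite msizeM //; apply: (@leq_trans (k.+1 + l.+1).-1).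
  by rewrite -!subn1 leq_sub2r ?leq_add.
by rewrite addnS.
Qed.

Lemma degree_leX d k l (p : {mpoly F[d]}) :
  degree_le k p -> degree_le (k * l) (p ^+ l).
Proof.
move=> pk; elim: l => [|l IH]; first by rewrite /degree_le muln0 expr0 msize1.
by rewrite exprS mulnS degree_leM.
Qed.

Lemma degree_le_prod d k e (p : 'I_e -> {mpoly F[d]}) :
  (forall i, degree_le k (p i)) -> degree_le (k * e) (\prod_i p i).
Proof.
elim: e p => [|e IH] p pk; first by rewrite /degree_le muln0 big_ord0 msize1.
by rewrite big_ord_recr mulnS addnC degree_leM // IH.
Qed.

(** The monomials of exponents at most N in d + 1 quotients, brought to a common
denominator, have numerators of degree O(N) in d variables.  There are
(N + 1) ^ (d + 1) of them in a space of dimension O(N ^ d), so that they are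
linearly dependent for large N. *)
Lemma algebraic_dependence d (p : 'I_d.+1 -> {mpoly F[d]}) (q : {mpoly F[d]}) :
  exists2 P : {mpoly F[d.+1]}, P != 0 &
    forall x, q.@[x] != 0 -> P.@[fun i => (p i).@[x] / q.@[x]] = 0.
Proof.
pose c := (msize q + \max_i msize (p i))%N.
have pc i : degree_le c (p i).
  by rewrite /degree_le leqW // (leq_trans (@leq_bigmax _ (fun j => msize (p j)) i)) ?leq_addl.
have qc : degree_le c q by rewrite /degree_le leqW ?leq_addr.
(* N is large enough for (K + 1) ^ d <= N (N + 1) ^ d, where K bounds the degrees
   of the polynomials w E and c those of the p i and of q. *)
pose N := ((c * d.+1).+1 ^ d)%N; pose K := (c * N * d.+1)%N.
pose w (E : {ffun 'I_d.+1 -> 'I_N.+1}) := \prod_i (p i ^+ E i * q ^+ (N - E i)).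
have wK E : degree_le K (w E).
  apply: degree_le_prod => i; have := ltn_ord (E i); rewrite ltnS => le_EN.
  by rewrite -[N in (c * N)%N](subnKC le_EN) mulnDr degree_leM ?degree_leX.
pose mon (e : {ffun 'I_d -> 'I_K.+1}) : 'X_{1..d} := [multinom (e i : nat) | i < d].
(* A vector in the left kernel of M is a linear relation between the w E. *)
pose M := \matrix_(i < #|{ffun 'I_d.+1 -> 'I_N.+1}|, j < #|{ffun 'I_d -> 'I_K.+1}|)
  (w (enum_val i))@_(mon (enum_val j)).
have : kermx M != 0.
  rewrite kermx_eq0 /row_free neq_ltn (leq_ltn_trans (rank_leq_col M)) //.
  rewrite !card_ffun !card_ord.
  apply: (@leq_ltn_trans (N * N.+1 ^ d)); last by rewrite expnS ltn_pmul2r ?expn_gt0.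
  rewrite -expnMn; have [->|d0] := posnP d; first by rewrite !expn0.
  rewrite leq_exp2r // mulSn addSn ltnS /K mulnAC.
  by apply: leq_trans (leq_addl _ _); rewrite leq_mul2l leqnSn orbT.
case/rowV0Pn => v /sub_kermxP vM v0.
pose P : {mpoly F[d.+1]} :=
  \sum_i v 0 i *: 'X_[[multinom (enum_val i j : nat) | j < d.+1]].
exists P => [|x qx].
  case/rV0Pn: v0 => i vi; apply: contra vi => /eqP P0.
  suff <- : P@_[multinom (enum_val i j : nat) | j < d.+1] = v 0 i by rewrite P0 mcoeff0.
  rewrite raddf_sum (bigD1 i) //= mcoeffZ mcoeffX eqxx mulr1 big1 ?addr0 // => j ji.
  rewrite mcoeffZ mcoeffX; case: eqP => [/mnmP e|]; last by rewrite mulr0.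
  case/eqP: ji; apply: enum_val_inj; apply/ffunP => k.
  by have := e k; rewrite !mnmE => /val_inj.
have w0 : \sum_i v 0 i *: w (enum_val i) = 0.
  apply/mpolyP => m; rewrite raddf_sum mcoeff0 /=.
  have [lt_mK|le_Km] := ltnP (mdeg m) K.+1; last first.
    rewrite big1 // => i _; rewrite mcoeffZ memN_msupp_eq0 ?mulr0 //.
    by apply: msize_mdeg_ge; apply: leq_trans le_Km; exact: wK.
  have mK i : (m i < K.+1)%N.
    by apply: leq_ltn_trans lt_mK; rewrite mdegE (bigD1 i) ?leq_addr.
  pose e : {ffun 'I_d -> 'I_K.+1} := [ffun i => Ordinal (mK i)].
  have -> : m = mon (enum_val (enum_rank e)).
    by apply/mnmP => i; rewrite mnmE enum_rankK ffunE.
  move/matrixP/(_ 0 (enum_rank e)): vM; rewrite !mxE => vMe; rewrite -[RHS]vMe.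
  by apply: eq_bigr => i _; rewrite mcoeffZ mxE.
pose X_ (E : {ffun 'I_d.+1 -> 'I_N.+1}) := \prod_i ((p i).@[x] / q.@[x]) ^+ E i.
have eX E : (w E).@[x] = X_ E * (q.@[x] ^+ N) ^+ d.+1.
  have -> : (q.@[x] ^+ N) ^+ d.+1 = \prod_(i < d.+1) q.@[x] ^+ N.
    by rewrite prodr_const card_ord.
  rewrite rmorph_prod -big_split /=.
  apply: eq_bigr => i _; rewrite rmorphM !rmorphXn /= expr_div_n -mulrA; congr (_ * _).
  have := ltn_ord (E i); rewrite ltnS => le_EN.
  have -> : q.@[x] ^+ N = q.@[x] ^+ E i * q.@[x] ^+ (N - E i).
    by rewrite -exprD subnKC.
  by rewrite mulKf // expf_neq0.
have /eqP := congr1 (meval x) w0; rewrite meval0 raddf_sum /=.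
have -> : \sum_i (v 0 i *: w (enum_val i)).@[x] =
    (\sum_i v 0 i * X_ (enum_val i)) * (q.@[x] ^+ N) ^+ d.+1.
  by rewrite mulr_suml; apply: eq_bigr => i _; rewrite mevalZ eX mulrA.
rewrite mulf_eq0 expf_eq0 expf_eq0 (negPf qx) !andbF orbF => /eqP <-.
rewrite raddf_sum; apply: eq_bigr => i _; rewrite /= mevalZ mevalX; congr (_ * _).
by apply: eq_bigr => j _; rewrite mnmE.
Qed.

(** The transcendence degree of the localized polynomial ring is at most d. *)
Lemma regular_dependence d (q : {mpoly F[d]}) (g : 'I_d.+1 -> ('I_d -> F) -> F) :
  (forall i, regular_on q (g i)) ->
  exists2 P : {mpoly F[d.+1]}, P != 0 &
    forall x, q.@[x] != 0 -> P.@[fun i => g i x] = 0.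
Proof.
move=> /choice[k] /choice[p gp].
pose N := \max_i k i; pose r i := p i * q ^+ (N - k i).
have [P P0 Pr] := algebraic_dependence r (q ^+ N); exists P => // x qx.
rewrite -[RHS](Pr x) ?rmorphXn ?expf_neq0 //; apply: meval_eq => i.
have le_kN : (k i <= N)%N by apply: leq_bigmax.
rewrite /r rmorphM !rmorphXn /= -gp // -(mulrA (g i x)) -exprD subnKC // mulfK //.
by rewrite expf_neq0.
Qed.

End PolynomialFunctions.

(** * Conjugation of pairs of matrices, and a criterion of irreducibility *)

Section Conjugation.
Variables (F : fieldType) (r : nat).
Implicit Types (AB : mxpair F r) (g h : 'M[F]_r).

Lemma invmx_mul g h : g \in unitmx -> h \in unitmx ->
  invmx (g *m h) = invmx h *m invmx g.
Proof.
move=> ug uh; have ugh : g *m h \in unitmx by rewrite unitmx_mul ug.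
by apply: (can_inj (mulKmx ugh)); rewrite mulmxV // mulmxA mulmxK // mulmxV.
Qed.

Lemma conj_pairM g h AB : g \in unitmx -> h \in unitmx ->
  conj_pair (g *m h) AB = conj_pair g (conj_pair h AB).
Proof. by move=> ug uh; rewrite /conj_pair /= invmx_mul // !mulmxA. Qed.

Lemma conj_pair1 AB : conj_pair 1%:M AB = AB.
Proof. by case: AB => A B; rewrite /conj_pair /= invmx1 !mul1mx !mulmx1. Qed.

Lemma conj_pairK g AB : g \in unitmx -> conj_pair (invmx g) (conj_pair g AB) = AB.
Proof.
by move=> ug; rewrite -conj_pairM ?unitmx_inv // mulVmx // conj_pair1.
Qed.

Lemma conj_orbit_refl AB : conj_orbit AB AB.
Proof. by exists 1%:M; rewrite ?unitmx1 ?conj_pair1. Qed.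

Lemma conj_orbit_conj g AB : g \in unitmx -> conj_orbit (conj_pair g AB) = conj_orbit AB.
Proof.
move=> ug; apply/seteqP; split=> CD [h uh ->].
  by exists (h *m g); rewrite ?unitmx_mul ?uh // conj_pairM.
exists (h *m invmx g); rewrite ?unitmx_mul ?uh ?unitmx_inv //.
by rewrite conj_pairM ?unitmx_inv // conj_pairK.
Qed.

Lemma expmx_conj g (A : 'M[F]_r) k : g \in unitmx ->
  (g *m A *m invmx g) ^+ k = g *m (A ^+ k) *m invmx g.
Proof.
move=> ug; elim: k => [|k IH]; first by rewrite !expr0 mulmx1 mulmxV.
by rewrite !exprS -!mulmxE IH !mulmxA mulmxKV.
Qed.

Lemma rep_variety_conj m n g AB : g \in unitmx ->
  rep_variety F m n r AB -> rep_variety F m n r (conj_pair g AB).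
Proof.
move=> ug [dA dB AB_eq]; have dg : \det g * \det (invmx g) = 1.
  by rewrite -det_mulmx mulmxV // det1.
by split; rewrite /= ?expmx_conj ?AB_eq // !det_mulmx ?dA ?dB mulr1.
Qed.

Lemma stablemx_conj g (A : 'M[F]_r) (U : 'M[F]_r) : g \in unitmx ->
  stablemx U (g *m A *m invmx g) = stablemx (U *m g) A.
Proof.
move=> ug; apply/idP/idP => /(submxMr _) H.
  by have := H _ g; rewrite !mulmxA mulmxKV.
by have := H _ (invmx g); rewrite !mulmxA mulmxK.
Qed.

Lemma irreducible_conj g AB : g \in unitmx ->
  irreducible_rep AB -> irreducible_rep (conj_pair g AB).
Proof.
move=> ug [r0 irrAB]; split=> // U []; rewrite /= !stablemx_conj // => sA sB.
by have := irrAB (U *m g) (conj sA sB); rewrite mxrankMfree // row_free_unit.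
Qed.

Lemma irreducible_semisimple AB : irreducible_rep AB -> semisimple_rep AB.
Proof.
case=> r0 irrAB U sU; have [rU|rU] := irrAB U sU.
  exists 1%:M; split; first by split; rewrite stableCmx.
    by move/eqP: rU; rewrite mxrank_eq0 => /eqP->; exact: adds0mx.
  by move/eqP: rU; rewrite mxrank_eq0 => /eqP->; rewrite cap0mx.
exists 0; split; first by split; rewrite stable0mx.
  apply: eqmx_trans (addsmx0 _ _) _; apply/eqmx_sym/eqmxP.
  by rewrite submx1 sub1mx /row_full rU eqxx.
by rewrite capmx0.
Qed.

Lemma irr_locus_char_variety m n : irr_locus F m n r `<=` char_variety F m n r.
Proof.
move=> O [AB [rep irr ->]]; exists AB; split=> //.
exact: irreducible_semisimple.
Qed.

End Conjugation.

Section Projector.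
Variables (F : fieldType) (r : nat).
Implicit Types (A U : 'M[F]_r.+1) (lam mu : 'rV[F]_r.+1).

(** The eigenvalue [mu 0 j] of [diag_mx mu] has multiplicity one. *)
Definition simple_entry mu j := forall k, k != j -> mu 0 k != mu 0 j.

(** The product runs over indices rather than over distinct values, so that repeated
entries of mu are allowed away from j. *)
Definition lagrange_poly mu j : {poly F} :=
  \prod_(k | k != j) ((mu 0 j - mu 0 k)^-1 *: ('X - (mu 0 k)%:P)).

Lemma horner_lagrange_poly mu j i : simple_entry mu j ->
  (lagrange_poly mu j).[mu 0 i] = (i == j)%:R.
Proof.
move=> mu_j; rewrite /lagrange_poly horner_prod; case: eqVneq => [->|ij].
  by rewrite big1 // => k kj; rewrite !hornerE mulVf // subr_eq0 eq_sym mu_j.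
by rewrite (bigD1 i) //= !hornerE subrr mulr0 mul0r.
Qed.

(** For a diagonalizable A with eigenvalues mu, the projection onto the eigenspace
of [mu 0 j] along the other eigenspaces.  As a polynomial in A it preserves the
subspaces that A preserves, and it depends polynomially on the entries of A. *)
Definition eigenprojector mu j A : 'M[F]_r.+1 := horner_mx A (lagrange_poly mu j).

Lemma eigenprojector_diag mu j : simple_entry mu j ->
  eigenprojector mu j (diag_mx mu) = delta_mx j j.
Proof.
move=> mu_j; rewrite /eigenprojector horner_mx_diag; apply/matrixP => a b.
rewrite !mxE horner_lagrange_poly //; have [->|ab] := eqVneq a b.
  by rewrite andbb.
rewrite mulr0n; case: andP => // -[/eqP aj /eqP bj].
by rewrite aj bj eqxx in ab.
Qed.

Lemma eigenprojector_conj mu j (H K A : 'M[F]_r.+1) : K *m H = 1%:M ->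
  eigenprojector mu j (H *m A *m K) = H *m eigenprojector mu j A *m K.
Proof.
move=> KH; have HK := mulmx1C KH; have [uH uK] := mulmx1_unit HK.
have -> : K = invmx H by apply: (can_inj (mulKmx uH)); rewrite mulmxV.
exact: horner_mx_uconj.
Qed.

Lemma mulmx_delta (v : 'rV[F]_r.+1) k : v *m delta_mx k k = v 0 k *: delta_mx 0 k.
Proof.
apply/rowP => l; rewrite !mxE (bigD1 k) //= big1 ?addr0 => [|i /negPf ik].
  by rewrite mxE eqxx.
by rewrite mxE ik mulr0.
Qed.

Lemma mulmx_deltaE (H K : 'M[F]_r.+1) j a b : (H *m delta_mx j j *m K) a b = H a j * K j b.
Proof.
have -> : (H *m delta_mx j j *m K) a b = (row a H *m delta_mx j j *m K) 0 b.
  by rewrite -!row_mul [RHS]mxE.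
by rewrite mulmx_delta -scalemxAl -rowE !mxE.
Qed.

(** A nonzero invariant subspace contains a basis vector e_i, by the projections of
the first matrix; the projection of rank one of the second matrix has only
nonzero entries, and moves e_i to a vector with all coordinates nonzero, whence
all basis vectors. *)
Lemma irreducible_diag lam mu j (H K : 'M[F]_r.+1) :
  injective (lam 0) -> simple_entry mu j -> K *m H = 1%:M ->
  (forall i, H i j != 0) -> (forall i, K j i != 0) ->
  irreducible_rep (diag_mx lam, H *m diag_mx mu *m K).
Proof.
move=> lam_inj mu_j KH H0 K0; split=> // U [/= sA sB].
have lam_simple i : simple_entry lam i.
  by move=> k; apply: contra => /eqP/lam_inj->.
have sE i : stablemx U (delta_mx i i).
  by rewrite -(eigenprojector_diag (lam_simple i)); exact: horner_mx_stable.
have sF : stablemx U (H *m delta_mx j j *m K).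
  rewrite -(eigenprojector_diag mu_j) -eigenprojector_conj //.
  exact: horner_mx_stable.
have [->|U0] := eqVneq U 0; first by left; rewrite mxrank0.
right; have /matrix0Pn[a [i Uai]] := U0.
have sub_delta (v : 'rV[F]_r.+1) k : (v <= U)%MS -> v 0 k != 0 ->
    ((delta_mx 0 k : 'rV[F]_r.+1) <= U)%MS.
  move=> vU vk; rewrite -[delta_mx 0 k](scalerK vk) scalemx_sub // -mulmx_delta.
  exact: submx_trans (submxMr _ vU) (sE k).
have ei : ((delta_mx 0 i : 'rV[F]_r.+1) <= U)%MS.
  by apply: (sub_delta (row a U)); rewrite ?row_sub // mxE.
apply/eqP; rewrite -[_ == _]/(row_full U) -sub1mx; apply/row_subP => k.
rewrite row1; apply: (sub_delta (delta_mx 0 i *m (H *m delta_mx j j *m K))).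
  exact: submx_trans (submxMr _ ei) sF.
by rewrite -rowE mxE mulmx_deltaE mulf_neq0.
Qed.

End Projector.

(** * Determinants, diagonal forms, and matrices with a scalar power *)

Section Determinants.
Variable F : fieldType.

Lemma det_sub_conj r (g A : 'M[F]_r) c : g \in unitmx ->
  \det (c%:M - g *m A *m invmx g) = \det (c%:M - A).
Proof.
move=> ug; have -> : c%:M - g *m A *m invmx g = g *m (c%:M - A) *m invmx g.
  by rewrite mulmxBr mulmxBl scalar_mxC mulmxK.
by rewrite !det_mulmx mulrAC -det_mulmx mulmxV // det1 mul1r.
Qed.

Lemma det_sub_diag r (d : 'rV[F]_r) c : \det (c%:M - diag_mx d) = \prod_i (c - d 0 i).
Proof.
rewrite -diag_const_mx -linearB /= det_diag.
by apply: eq_bigr => i _; rewrite !mxE.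
Qed.

Lemma detX r (A : 'M[F]_r) n : \det (A ^+ n) = \det A ^+ n.
Proof.
elim: n => [|n IH]; first by rewrite !expr0 det1.
by rewrite !exprS -mulmxE det_mulmx IH.
Qed.

Lemma rank_eigenspace_repeated r (g : 'M[F]_r) (d : 'rV[F]_r) i j :
  g \in unitmx -> i != j -> d 0 i = d 0 j ->
  (2 <= \rank (eigenspace (g *m diag_mx d *m invmx g) (d 0%R i)))%N.
Proof.
move=> ug ij dij; pose P : 'M[F]_(1 + 1, r) := col_mx (delta_mx 0 i) (delta_mx 0 j).
have <- : \rank (P *m invmx g) = 2%N.
  rewrite mxrankMfree ?row_free_unit ?unitmx_inv //.
  apply/eqP; rewrite -[_ == _]/(row_free P); apply/row_freeP.
  exists (row_mx (delta_mx i 0) (delta_mx j 0)).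
  rewrite mul_col_row scalar_mx_block; congr block_mx; rewrite ?mul_delta_mx;
    rewrite ?mul_delta_mx_0 // 1?eq_sym //; apply/matrixP => a b;
    by rewrite !ord1 !mxE.
apply: mxrankS; rewrite mul_col_mx col_mx_sub.
have eig k : ((delta_mx 0 k : 'rV[F]_r) *m invmx g <=
    eigenspace (g *m diag_mx d *m invmx g) (d 0 k))%MS.
  apply/eigenspaceP; rewrite !mulmxA mulmxKV // -(rowE k (diag_mx d)) row_diag_mx.
  by rewrite scalemxAl.
by rewrite eig dij eig.
Qed.

(** Two eigenspaces of dimension at least 2 of a space of dimension 3 meet, and a
common eigenvector spans an invariant line. *)
Lemma repeated_eigenvalues_reducible (g h : 'M[F]_3) (lam mu : 'rV[F]_3) i j k l :
  g \in unitmx -> h \in unitmx -> i != j -> lam 0 i = lam 0 j ->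
  k != l -> mu 0 k = mu 0 l ->
  ~ irreducible_rep (g *m diag_mx lam *m invmx g, h *m diag_mx mu *m invmx h).
Proof.
move=> ug uh ij lij kl mkl [_ irr].
have rA := rank_eigenspace_repeated ug ij lij.
have rB := rank_eigenspace_repeated uh kl mkl.
set EA := eigenspace _ (lam 0 i) in rA; set EB := eigenspace _ (mu 0 k) in rB.
have /rowV0Pn[v] : (EA :&: EB)%MS != 0.
  rewrite -mxrank_eq0 -lt0n; have := mxrank_sum_cap EA EB.
  have := rank_leq_row (EA + EB)%MS; have := leq_add rA rB => le4 le3 rk.
  by move: le4; rewrite -rk => /leq_trans/(_ (leq_add le3 (leqnn _))).
rewrite sub_capmx => /andP[/eigenspaceP vA /eigenspaceP vB] v0.
have rv : \rank <<v>>%MS = 1%N by rewrite genmxE rank_rV v0.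
have [||] := irr <<v>>%MS; rewrite ?rv //; split=> /=.
  by rewrite (eqmxMr _ (genmxE v)) genmxE vA scalemx_sub.
by rewrite (eqmxMr _ (genmxE v)) genmxE vB scalemx_sub.
Qed.

End Determinants.

Section DiagonalForm.
Variable F : numFieldType.

Lemma XnsubC_neq0 n (c : F) : (0 < n)%N -> 'X^n - c%:P != 0.
Proof. by move=> n0; rewrite -size_poly_gt0 size_XnsubC. Qed.

(** The derivative n x ^ (n - 1) does not vanish at a nonzero root. *)
Lemma mup_XnsubC n (c x : F) : (0 < n)%N -> c != 0 ->
  mup x ('X^n - c%:P) = (x ^+ n == c).
Proof.
move=> n0 c0; case: eqVneq => [xn|xn]; last first.
  by rewrite mupNroot // rootE !hornerE subr_eq0.
have x0 : x != 0 by apply: contra c0 => /eqP x0; rewrite -xn x0 expr0n eqn0Ngt n0.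
rewrite -xn polyC_exp subrXX mupMl; first by rewrite -['X - _]expr1 mup_XsubCX eqxx.
rewrite rootE horner_sum (eq_bigr (fun=> x ^+ n.-1)) => [|i _]; last first.
  rewrite -polyC_exp !hornerE -exprD subnK //.
  by case: n n0 i {xn} => // n _ i /=; rewrite -ltnS ltn_ord.
rewrite sumr_const card_ord -mulr_natr mulf_neq0 ?expf_neq0 //.
by rewrite Num.Theory.pnatr_eq0 -lt0n.
Qed.

(** The products are the characteristic polynomials, so that the entries of d and e
agree up to a permutation. *)
Lemma diag_mx_perm r (d e : 'rV[F]_r) :
  (forall c, \prod_i (c - d 0 i) = \prod_i (c - e 0 i)) ->
  exists2 g, g \in unitmx & diag_mx d = g *m diag_mx e *m invmx g.
Proof.
move=> de; have pe : \prod_(x <- [tuple d 0 i | i < r]) ('X - x%:P) =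
    \prod_(x <- [tuple e 0 i | i < r]) ('X - x%:P).
  apply/eqP; rewrite -subr_eq0; apply: contraT => /poly_nonroot[c].
  rewrite !big_tuple hornerD hornerN !horner_prod.
  under eq_bigr => i _ do rewrite tnth_mktuple hornerXsubC.
  under [X in _ - X]eq_bigr => i _ do rewrite tnth_mktuple hornerXsubC.
  by rewrite de subrr eqxx.
have /tuple_permP[s s_eq] := prod_XsubC_eq pe.
have ds i : d 0 i = e 0 (s i).
  have := congr1 (fun u => nth 0 u i) s_eq.
  by rewrite -!tnth_nth !tnth_mktuple.
exists (perm_mx s); first exact: unitmx_perm.
apply: (canRL (mulmxK (unitmx_perm _ s))); apply/matrixP => i j.
rewrite mul_diag_mx mul_mx_diag !mxE ds mulrC.
by case: eqP => [->|]; rewrite ?mulr0 ?mul0r.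
Qed.

Lemma diagonal_form r (A g : 'M[F]_r) (d e : 'rV[F]_r) :
  g \in unitmx -> A = g *m diag_mx d *m invmx g ->
  (forall c, \det (c%:M - A) = \prod_i (c - e 0 i)) ->
  exists2 h, h \in unitmx & A = h *m diag_mx e *m invmx h.
Proof.
move=> ug -> de; have [c|h uh ->] := @diag_mx_perm _ d e.
  by rewrite -de det_sub_conj // det_sub_diag.
by exists (g *m h); rewrite ?unitmx_mul ?ug // invmx_mul // !mulmxA.
Qed.

End DiagonalForm.

Section FiniteOrder.
Variable F : numClosedFieldType.

Lemma XnsubC_split n (c : F) : (0 < n)%N -> c != 0 ->
  exists2 s, uniq s & 'X^n - c%:P = \prod_(x <- s) ('X - x%:P).
Proof.
move=> n0 c0; have [s] := closed_field_poly_normal ('X^n - c%:P).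
rewrite lead_coefXnsubC // scale1r => ps; exists s => //.
apply: count_mem_uniq => x.
rewrite -mu_prod_XsubC -ps mup_XnsubC // -root_prod_XsubC -ps rootE !hornerE.
by rewrite subr_eq0.
Qed.

(** A finite list contains all the eigenvalues that can occur, independently of the
root of unity omega. *)
Lemma root_list_index r (lam : 'rV[F]_r) k l (s : seq F) omega :
  'X^(k * l) - 1%:P = \prod_(x <- s) ('X - x%:P) ->
  omega ^+ l = 1 -> (forall i, lam 0 i ^+ k = omega) ->
  exists f : {ffun 'I_r -> 'I_(size s)}, forall i, lam 0 i = s`_(f i).
Proof.
move=> ps w1 lam_k.
have lam_s i : lam 0 i \in s.
  by rewrite -root_prod_XsubC -ps rootE !hornerE exprM lam_k w1 subrr.
have ind (i : 'I_r) : (index (lam 0%R i) s < size s)%N by rewrite index_mem.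
by exists [ffun i => Ordinal (ind i)] => i; rewrite ffunE nth_index.
Qed.

(** The minimal polynomial of A divides X ^ n - omega, which has simple roots. *)
Lemma diagonalizable_root n r (A : 'M[F]_r.+1) omega :
  (0 < n)%N -> omega != 0 -> A ^+ n = omega%:M ->
  exists g d, [/\ g \in unitmx, A = g *m diag_mx d *m invmx g &
                  forall i, d 0 i ^+ n = omega].
Proof.
move=> n0 w0 An; have [s us ps] := XnsubC_split n0 w0.
have pA : horner_mx A ('X^n - omega%:P) = 0.
  by rewrite rmorphB rmorphXn /= horner_mx_X horner_mx_C An subrr.
have /diagonalizableP[P uP /(diagonalizable_forLR uP)[d]] :
    exists2 rs, uniq rs & mxminpoly A %| \prod_(x <- rs) ('X - x%:P).
  by exists s => //; rewrite -ps; apply: mxminpoly_min.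
rewrite mxpoly.conjVmx // -{2}(invmxK P) => A_eq.
have uV : invmx P \in unitmx by rewrite unitmx_inv.
exists (invmx P), d; split => // i.
move: pA; rewrite A_eq horner_mx_uconj // => /(canRL (mulmxKV uV))/(canRL (mulKmx uV)).
rewrite mul0mx mulmx0 horner_mx_diag => /matrixP/(_ i i).
by rewrite !mxE eqxx mulr1n !hornerE => /eqP; rewrite subr_eq0 => /eqP.
Qed.

(** Schur: an eigenspace of Z is invariant. *)
Lemma irreducible_scalar r (AB : mxpair F r) (Z : 'M[F]_r) :
  irreducible_rep AB -> comm_mx Z AB.1 -> comm_mx Z AB.2 ->
  exists omega, Z = omega%:M.
Proof.
move=> [r0 irr] ZA ZB; have [w wZ] := eigenvalue_closed Z r0; exists w.
have [] := irr (eigenspace Z w).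
- by split; apply: comm_mx_stable_eigenspace.
- by move/eqP; rewrite mxrank_eq0 (negPf wZ).
move=> rk; have : (1%:M <= eigenspace Z w)%MS by rewrite sub1mx /row_full rk.
by move/eigenspaceP; rewrite mul1mx scalemx1.
Qed.

Lemma irreducible_rep_eigenvalues m n r (AB : mxpair F r.+1) :
  (0 < m)%N -> (0 < n)%N -> rep_variety F m n r.+1 AB -> irreducible_rep AB ->
  exists omega (lam mu : 'rV[F]_r.+1) g h, [/\ omega ^+ r.+1 = 1,
    forall i, lam 0 i ^+ n = omega, forall i, mu 0 i ^+ m = omega,
    [/\ g \in unitmx & AB.1 = g *m diag_mx lam *m invmx g] &
    [/\ h \in unitmx & AB.2 = h *m diag_mx mu *m invmx h]].
Proof.
move=> m0 n0 [dA dB AB_eq] irr.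
have [||w An] := @irreducible_scalar _ _ (AB.1 ^+ n) irr.
- exact: (commr_sym (commrX n (commr_refl AB.1))).
- by rewrite AB_eq; exact: (commr_sym (commrX m (commr_refl AB.2))).
have w1 : w ^+ r.+1 = 1 by rewrite -det_scalar -An -[RHS](expr1n _ n) -dA -detX.
have w0 : w != 0 by apply/eqP => w0; move/eqP: w1; rewrite w0 expr0n eq_sym oner_eq0.
have [g [lam [ug Ag lam_n]]] := diagonalizable_root n0 w0 An.
rewrite An in AB_eq; have [h [mu [uh Bh mu_m]]] := diagonalizable_root m0 w0 (esym AB_eq).
by exists w, lam, mu, g, h.
Qed.

End FiniteOrder.

(** * Invariant functions and the Zariski topology of the quotient *)

Section RegularFunctions.
Variables (F : fieldType) (r : nat).
Implicit Types (AB : mxpair F r).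

Definition coord_mx1 : 'M[{mpoly F[r * r + r * r]}]_r :=
  \matrix_(i, j) 'X_(lshift _ (mxvec_index i j)).

Definition coord_mx2 : 'M[{mpoly F[r * r + r * r]}]_r :=
  \matrix_(i, j) 'X_(rshift _ (mxvec_index i j)).

(** The point at which [reg_eval] evaluates polynomials. *)
Definition coord AB : 'I_(r * r + r * r) -> F :=
  fun k => row_mx (mxvec AB.1) (mxvec AB.2) 0 k.

Lemma reg_eval_mx1 AB : map_mx (meval (coord AB)) coord_mx1 = AB.1.
Proof. by apply/matrixP => i j; rewrite !mxE mevalXU /coord row_mxEl mxvecE. Qed.

Lemma reg_eval_mx2 AB : map_mx (meval (coord AB)) coord_mx2 = AB.2.
Proof. by apply/matrixP => i j; rewrite !mxE mevalXU /coord row_mxEr mxvecE. Qed.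

Definition char_fun1 (c : F) : regfun F r := \det ((c%:MP)%:M - coord_mx1).
Definition char_fun2 (c : F) : regfun F r := \det ((c%:MP)%:M - coord_mx2).

Lemma char_fun1E c AB : reg_eval (char_fun1 c) AB = \det (c%:M - AB.1).
Proof.
by rewrite /reg_eval -/(coord AB) -det_map_mx map_mxB map_scalar_mx /= mevalC reg_eval_mx1.
Qed.

Lemma char_fun2E c AB : reg_eval (char_fun2 c) AB = \det (c%:M - AB.2).
Proof.
by rewrite /reg_eval -/(coord AB) -det_map_mx map_mxB map_scalar_mx /= mevalC reg_eval_mx2.
Qed.

End RegularFunctions.

Section TraceFunctions.
Variables (F : fieldType) (r : nat).
Implicit Types (AB : mxpair F r.+1).

(** Since conjugation changes neither p(A) nor q(B) except by the same conjugation,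
tr(p(A) q(B)) is an invariant. *)
Definition trace_fun (p q : {poly F}) : regfun F r.+1 :=
  \tr (horner_mx (coord_mx1 F r.+1) (map_poly (@mpolyC _ F) p) *m
       horner_mx (coord_mx2 F r.+1) (map_poly (@mpolyC _ F) q)).

Lemma trace_funE p q AB :
  reg_eval (trace_fun p q) AB = \tr (horner_mx AB.1 p *m horner_mx AB.2 q).
Proof.
rewrite /reg_eval -/(coord AB) -trace_map_mx map_mxM !map_horner_mx.
rewrite reg_eval_mx1 reg_eval_mx2 -!map_poly_comp.
by rewrite !map_poly_id // => c _ /=; rewrite mevalC.
Qed.

Lemma trace_fun_invariant m n p q : invariant_fun m n (trace_fun p q).
Proof.
move=> AB g _ ug; rewrite !trace_funE /= !horner_mx_uconj //.
by rewrite !mulmxA mulmxKV // mxtrace_mulC !mulmxA mulVmx // mul1mx.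
Qed.

End TraceFunctions.

Section Zariski.
Variables (F : fieldType) (m n r : nat).
Local Notation X := (char_variety F m n r).
Local Notation invariant := (@invariant_fun F m n r).
Implicit Types (f g : regfun F r) (O : set (mxpair F r)) (S T : set (set (mxpair F r))).

Lemma char_fun1_invariant c : invariant (@char_fun1 F r c).
Proof.
by move=> AB g _ ug; rewrite !char_fun1E det_sub_conj.
Qed.

Lemma char_fun2_invariant c : invariant (@char_fun2 F r c).
Proof. by move=> AB g _ ug; rewrite !char_fun2E det_sub_conj. Qed.

(** An invariant is constant on an orbit, so that one representative suffices. *)
Lemma vanishes_at_orbit (f : regfun F r) AB : invariant f -> rep_variety F m n r AB ->
  reg_eval f AB = 0 -> vanishes_at f (conj_orbit AB).
Proof. by move=> invf repAB f0 CD [g ug ->]; rewrite invf. Qed.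

Lemma invariant_const c : invariant (c%:MP).
Proof. by move=> AB g _ _; rewrite /reg_eval !mevalC. Qed.

Lemma invariantB f g : invariant f -> invariant g -> invariant (f - g).
Proof.
by move=> If Ig AB h rAB uh; rewrite /reg_eval !mevalB -!/(reg_eval _ _) If ?Ig.
Qed.

Lemma invariant_prod I (s : seq I) (f : I -> regfun F r) :
  (forall i, invariant (f i)) -> invariant (\prod_(i <- s) f i).
Proof.
move=> If AB h rAB uh; rewrite /reg_eval !rmorph_prod.
by apply: eq_bigr => i _; exact: If.
Qed.

Lemma zclosure_point S O : X O ->
  (forall f, invariant f -> (forall P, S P -> vanishes_at f P) -> vanishes_at f O) ->
  zclosure m n S O.
Proof.
move=> XO fO Z [[I invI ->] SZ]; split=> // f If; apply: fO; first exact: invI.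
by move=> P /SZ[_]; apply.
Qed.

Lemma zclosure_vanishes S O f : S `<=` X -> invariant f ->
  (forall P, S P -> vanishes_at f P) -> zclosure m n S O -> X O /\ vanishes_at f O.
Proof.
move=> SX invf fS /(_ (zero_locus m n [set f])) [].
  split; first by exists [set f] => // g ->.
  by move=> P SP; split; [exact: SX | move=> g ->; exact: fS].
by move=> XO fO; split=> //; exact: fO.
Qed.

Lemma zclosure_subset S T : S `<=` T -> zclosure m n S `<=` zclosure m n T.
Proof. by move=> ST O SO Z [Zc TZ]; apply: SO; split=> //; exact: subset_trans TZ. Qed.

(** A finite union of closed sets is closed.  The zero locus of the family [I t] is
the t-th closed set, and if O is in none of them, then a product of functions
that do not vanish at O vanishes on S. *)
Lemma zclosure_finite_cover (T : finType) (I : T -> set (regfun F r)) S O :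
  S `<=` X -> (forall t, I t `<=` invariant) ->
  (forall P, S P -> exists t, forall f, I t f -> vanishes_at f P) ->
  zclosure m n S O -> exists t, forall f, I t f -> vanishes_at f O.
Proof.
move=> SX invI cover SO; apply: contrapT => notO.
have /choice[f fI] : forall t, exists f, I t f /\ ~ vanishes_at f O.
  move=> t; apply: contrapT => no_f; apply: notO; exists t => f If.
  by apply: contrapT => fO; apply: no_f; exists f.
have inv_prod : invariant (\prod_t f t).
  by apply: invariant_prod => t; apply: (invI t); exact: (fI t).1.
have [|[AB [rAB _ OE]] /(_ AB)] := zclosure_vanishes SX inv_prod _ SO.
  move=> P SP AB PAB; have [t It] := cover P SP.
  rewrite /reg_eval rmorph_prod (bigD1 t) //= -/(reg_eval _ _).
  by rewrite (It _ (fI t).1) // mul0r.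
rewrite OE => /(_ (conj_orbit_refl AB))/eqP; rewrite /reg_eval rmorph_prod.
move/prodf_eq0 => [t _ /eqP ft0]; apply: (fI t).2; rewrite OE.
by apply: vanishes_at_orbit => //; apply: (invI t); exact: (fI t).1.
Qed.

(** The level sets of f are closed, and finitely many of them cover S. *)
Lemma zirreducible_constant (s : seq F) f S : S `<=` X -> invariant f ->
  zirreducible m n S ->
  (forall O AB, S O -> O AB -> reg_eval f AB \in s) ->
  exists2 c, c \in s & forall O AB, S O -> O AB -> reg_eval f AB = c.
Proof.
move=> SX If [[O0 SO0] irrS] fs.
have [AB0 [rAB0 _ O0E]] := SX _ SO0.
suff [c cs fc] : exists2 c, c \in s & S `<=` zero_locus m n [set f - c%:MP].
  exists c => // O AB SO OAB; have [_ /(_ _ erefl)/(_ AB OAB)] := fc O SO.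
  by rewrite /reg_eval mevalB mevalC => /eqP; rewrite subr_eq0 => /eqP.
have closed_level (t : seq F) : zclosed m n (zero_locus m n [set \prod_(c <- t) (f - c%:MP)]).
  exists [set \prod_(c <- t) (f - c%:MP)] => // g ->; apply: invariant_prod => c.
  exact/invariantB/invariant_const.
have : S `<=` zero_locus m n [set \prod_(c <- s) (f - c%:MP)].
  move=> O SO; split; [exact: SX | move=> g -> AB OAB].
  rewrite /reg_eval rmorph_prod (big_rem _ (fs O AB SO OAB)) /=.
  by rewrite mevalB mevalC subrr mul0r.
elim: (s) => [|c t IH].
  move=> /(_ O0 SO0)[_ /(_ _ erefl AB0)]; rewrite O0E => /(_ (conj_orbit_refl AB0))/eqP.
  by rewrite big_nil /reg_eval meval1 oner_eq0.
move=> Sct; have := irrS _ _ (closed_level [:: c]) (closed_level t); rewrite big_seq1.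
case=> [O SO|Sc|/IH[d dt Sd]]; last 2 first.
- by exists c; rewrite ?mem_head.
- by exists d; rewrite // in_cons dt orbT.
have [XO /(_ _ erefl) ct0] := Sct O SO.
have [AB [rAB _ OE]] := XO.
have := ct0 AB; rewrite OE => /(_ (conj_orbit_refl AB))/eqP.
rewrite big_cons /reg_eval mevalM mulf_eq0.
have inv_c : invariant (f - c%:MP) by exact/invariantB/invariant_const.
case/orP => /eqP e0; [left|right]; split=> //; rewrite -?OE // => g ->;
  rewrite OE; apply: vanishes_at_orbit => //.
by apply: invariant_prod => d; exact/invariantB/invariant_const.
Qed.

End Zariski.

(** * Irreducible representations with prescribed eigenvalues *)

Section GenericMatrix.
Variables (F : fieldType) (r : nat).

(** A dense open condition on h that makes D_lam and h D_mu h^-1 generate an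
irreducible representation in all the cases that are needed. *)
Definition general_position (h : 'M[F]_r) :=
  h \in unitmx /\ forall i j, h i j != 0 /\ invmx h i j != 0.

Definition mx_of (x : 'I_(r * r) -> F) : 'M[F]_r := \matrix_(i, j) x (mxvec_index i j).

Definition generic_mx : 'M[{mpoly F[r * r]}]_r := \matrix_(i, j) 'X_(mxvec_index i j).

Definition general_poly : {mpoly F[r * r]} :=
  \det generic_mx * \prod_i \prod_j (generic_mx i j * (\adj generic_mx) i j).

Lemma mx_of_surj (h : 'M[F]_r) : exists x, mx_of x = h.
Proof.
by exists (fun k => mxvec h 0 k); apply/matrixP => i j; rewrite mxE mxvecE.
Qed.

Lemma meval_generic_mx x : map_mx (meval x) generic_mx = mx_of x.
Proof. by apply/matrixP => i j; rewrite !mxE mevalXU. Qed.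

Lemma meval_det_generic x : (\det generic_mx).@[x] = \det (mx_of x).
Proof. by rewrite -det_map_mx meval_generic_mx. Qed.

Lemma det_generic_unit x : ((\det generic_mx).@[x] != 0) = (mx_of x \in unitmx).
Proof. by rewrite meval_det_generic unitmxE unitfE. Qed.

Lemma meval_adj_generic x i j : ((\adj generic_mx) i j).@[x] = (\adj (mx_of x)) i j.
Proof. by rewrite -meval_generic_mx -map_mx_adj [RHS]mxE. Qed.

Lemma general_polyP x : general_poly.@[x] != 0 -> general_position (mx_of x).
Proof.
rewrite mevalM mulf_eq0 negb_or det_generic_unit => /andP[uh].
rewrite rmorph_prod => /prodf_neq0 h0; split=> // i j.
have := h0 i isT; rewrite rmorph_prod => /prodf_neq0/(_ j isT).
rewrite rmorphM /= meval_adj_generic mxE mevalXU mulf_eq0 negb_or => /andP[hij aij].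
rewrite mxE; split=> //; rewrite /invmx uh mxE mulf_neq0 //.
by rewrite invr_eq0 -unitfE -unitmxE.
Qed.

Lemma det_generic_neq0 : \det generic_mx != 0.
Proof.
have [x x1] := mx_of_surj 1%:M; apply/eqP => /(congr1 (meval x)).
by rewrite meval_det_generic x1 det1 meval0 => /eqP; rewrite oner_eq0.
Qed.

Lemma general_poly_neq0 : general_poly != 0.
Proof.
rewrite /general_poly mulf_neq0 ?det_generic_neq0 //.
apply/prodf_neq0 => i _; apply/prodf_neq0 => j _; rewrite mulf_neq0 //.
  by rewrite mxE -msize_poly_eq0 msizeX mdeg1.
(* The inverse of a transposition matrix has a nonzero (i, j) entry when the
   transposition exchanges i and j, and hence so does its adjugate. *)
have [x xs] := mx_of_surj (perm_mx (tperm i j)).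
apply/eqP => /(congr1 (meval x)); rewrite meval0 meval_adj_generic xs => a0.
have /matrixP/(_ j j) := mul_mx_adj (perm_mx (tperm i j) : 'M[F]_r).
rewrite -row_permE mxE tpermR a0 [RHS]mxE eqxx mulr1n => /esym/eqP.
by rewrite det_perm signr_eq0.
Qed.

End GenericMatrix.

Section RegularPairs.
Variables (F : numFieldType) (r d : nat) (q : {mpoly F[d]}).

Definition regular_mx_on (f : ('I_d -> F) -> 'M[F]_r) :=
  forall i j, regular_on q (fun x => f x i j).

Lemma regular_reg_eval (Psi : ('I_d -> F) -> mxpair F r) (f : regfun F r) :
  regular_mx_on (fun x => (Psi x).1) -> regular_mx_on (fun x => (Psi x).2) ->
  regular_on q (fun x => reg_eval f (Psi x)).
Proof.
move=> r1 r2; apply: regular_meval => k.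
case: (split_ordP k) => l ->; case/mxvec_indexP: l => i j.
  by apply: regular_eq (r1 i j) => x _; rewrite row_mxEl mxvecE.
by apply: regular_eq (r2 i j) => x _; rewrite row_mxEr mxvecE.
Qed.

Lemma regular_mx_const (A : 'M[F]_r) : regular_mx_on (fun=> A).
Proof. by move=> i j; exact: regular_const. Qed.

Lemma regular_mxM f g : regular_mx_on f -> regular_mx_on g ->
  regular_mx_on (fun x => f x *m g x).
Proof.
move=> rf rg i j; apply: (@regular_eq _ _ _ _ (fun x => \sum_k f x i k * g x k j)).
  by move=> x _; rewrite mxE.
by apply: regular_sum => k; apply: regular_mul.
Qed.

End RegularPairs.

Section Stratum.
Variables (F : numClosedFieldType) (m n r : nat) (lam mu : 'rV[F]_r.+1).
Hypotheses (m_gt0 : (0 < m)%N) (n_gt0 : (0 < n)%N).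

(** Up to conjugation, every pair of diagonalizable matrices with eigenvalues lam
and mu has this form: h is the change of basis between two eigenbases. *)
Definition diag_pair (h : 'M[F]_r.+1) : mxpair F r.+1 :=
  (diag_mx lam, h *m diag_mx mu *m invmx h).

Definition stratum : set (set (mxpair F r.+1)) :=
  [set O | exists h, [/\ h \in unitmx, irreducible_rep (diag_pair h)
                       & O = conj_orbit (diag_pair h)]].

(** The conditions on the eigenvalues that make the pairs representations in SL
such that A ^ n = B ^ m is the scalar omega. *)
Definition central_eigenvalues omega :=
  [/\ \prod_i lam 0 i = 1, \prod_i mu 0 i = 1,
      forall i, lam 0 i ^+ n = omega & forall i, mu 0 i ^+ m = omega].

Hypothesis central : exists omega, central_eigenvalues omega.
Hypothesis general_irreducible :
  forall h, general_position h -> irreducible_rep (diag_pair h).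

Lemma rep_diag_pair h : h \in unitmx -> rep_variety F m n r.+1 (diag_pair h).
Proof.
move=> uh; have [w [lam1 mu1 lam_n mu_m]] := central.
have expd k (d : 'rV[F]_r.+1) : (forall i, d 0 i ^+ k = w) -> diag_mx d ^+ k = w%:M.
  move=> dk; rewrite -[diag_mx d ^+ k](_ : horner_mx (diag_mx d) 'X^k = _); last first.
    by rewrite rmorphXn /= horner_mx_X.
  rewrite horner_mx_diag -diag_const_mx; congr diag_mx; apply/rowP => i.
  by rewrite !mxE hornerXn dk.
split => /=.
- by rewrite det_diag lam1.
- by rewrite !det_mulmx mulrAC -det_mulmx mulmxV // det1 mul1r det_diag mu1.
- by rewrite expmx_conj // !expd // scalar_mxC mulmxK.
Qed.

Lemma regular_diag_pair2 d (G : 'M[{mpoly F[d]}]_r.+1) :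
  regular_mx_on (\det G) (fun x => (diag_pair (map_mx (meval x) G)).2).
Proof.
have poly_entry (H : 'M[{mpoly F[d]}]_r.+1) :
    regular_mx_on (\det G) (fun x => map_mx (meval x) H).
  by move=> i j; apply: regular_eq (regular_poly _ (H i j)) => x _; rewrite mxE.
apply: regular_mxM; first apply: regular_mxM.
- exact: poly_entry.
- exact: regular_mx_const.
move=> i j; apply: regular_eq (regular_mul (regular_inv _) (poly_entry (\adj G) i j)).
move=> x; rewrite -det_map_mx => Gx.
by rewrite /invmx unitmxE unitfE Gx mxE map_mx_adj.
Qed.

Lemma regular_diag_pair d (G : 'M[{mpoly F[d]}]_r.+1) (f : regfun F r.+1) :
  regular_on (\det G) (fun x => reg_eval f (diag_pair (map_mx (meval x) G))).
Proof. by apply: regular_reg_eval; [exact: regular_mx_const | exact: regular_diag_pair2]. Qed.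

Lemma regular_generic_pair (f : regfun F r.+1) :
  regular_on (\det (generic_mx F r.+1)) (fun x => reg_eval f (diag_pair (mx_of x))).
Proof.
by apply: regular_eq (regular_diag_pair (generic_mx F r.+1) f) => x _; rewrite meval_generic_mx.
Qed.

(** Matrices in general position are dense among the invertible ones. *)
Lemma general_diag_pair_vanish (f : regfun F r.+1) :
  (forall h, general_position h -> reg_eval f (diag_pair h) = 0) ->
  forall h, h \in unitmx -> reg_eval f (diag_pair h) = 0.
Proof.
move=> f0 h uh; have [x xh] := mx_of_surj h; rewrite -xh.
apply: (regular_density (det_generic_neq0 _ _) (general_poly_neq0 _ _) (regular_generic_pair f)).
  by move=> y _ /general_polyP; exact: f0.
by rewrite det_generic_unit xh.
Qed.

Lemma stratum_general h : general_position h -> stratum (conj_orbit (diag_pair h)).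
Proof. by move=> gh; exists h; split=> //; [case: gh | exact: general_irreducible]. Qed.

Lemma stratum_irr_locus : stratum `<=` irr_locus F m n r.+1.
Proof.
by move=> O [h [uh irr ->]]; exists (diag_pair h); split=> //; exact: rep_diag_pair.
Qed.

(** An invariant that vanishes on the stratum vanishes at (D_lam, h D_mu h^-1) for h
in general position, hence for every invertible h. *)
Lemma stratum_closure g h : g \in unitmx -> h \in unitmx ->
  semisimple_rep (conj_pair g (diag_pair h)) ->
  zclosure m n stratum (conj_orbit (conj_pair g (diag_pair h))).
Proof.
move=> ug uh ssh; have rh := rep_diag_pair uh; apply: zclosure_point.
  by exists (conj_pair g (diag_pair h)); split=> //; exact: rep_variety_conj.
move=> f If fS; rewrite conj_orbit_conj //; apply: (vanishes_at_orbit If rh).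
apply: (general_diag_pair_vanish _ uh) => k gk.
by apply: fS (stratum_general gk) _ _; exact: conj_orbit_refl.
Qed.

(** The stratum is parametrized by an open set of matrices h, and the functions of h
that come from invariants have no zero divisors. *)
Lemma stratum_zirreducible : zirreducible m n stratum.
Proof.
have SX : stratum `<=` char_variety F m n r.+1.
  exact: subset_trans stratum_irr_locus (@irr_locus_char_variety _ _ _ _).
split.
  have [x /general_polyP gx] := mpoly_nonroot (general_poly_neq0 F r.+1).
  by exists (conj_orbit (diag_pair (mx_of x))); exact: stratum_general.
move=> _ _ [I1 inv1 ->] [I2 inv2 ->] S12.
have not_vanish (I : set (regfun F r.+1)) : I `<=` @invariant_fun F m n r.+1 ->
    ~ stratum `<=` zero_locus m n I ->
    exists f h, [/\ I f, h \in unitmx & reg_eval f (diag_pair h) != 0].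
  move=> invI; apply: contra_notP => noI O SO; split; first exact: SX.
  move=> f If; have [h [uh irr OE]] := SO; rewrite OE.
  apply: (vanishes_at_orbit (invI f If) (rep_diag_pair uh)).
  by apply/eqP/contraT => fh; case: noI; exists f, h.
apply: contrapT => /not_orP[/(not_vanish _ inv1)[f [h [If uh fh]]]].
move=> /(not_vanish _ inv2)[g [k [Ig uk gk]]].
have fg0 l : general_position l ->
    reg_eval f (diag_pair l) * reg_eval g (diag_pair l) = 0.
  move=> gl; have [[_ v]|[_ v]] := S12 _ (stratum_general gl).
    by rewrite (v f If _ (conj_orbit_refl _)) mul0r.
  by rewrite (v g Ig _ (conj_orbit_refl _)) mulr0.
have {}fg0 l : l \in unitmx -> reg_eval (f * g) (diag_pair l) = 0.
  by apply: general_diag_pair_vanish => {l} l; rewrite /reg_eval mevalM; exact: fg0.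
have fg_reg x : (\det (generic_mx F r.+1)).@[x] != 0 ->
    reg_eval f (diag_pair (mx_of x)) * reg_eval g (diag_pair (mx_of x)) = 0.
  by rewrite det_generic_unit => /fg0; rewrite /reg_eval mevalM.
have [e0|e0] := regular_eq0 (det_generic_neq0 _ _) (regular_generic_pair f)
  (regular_generic_pair g) fg_reg.
- have [x xh] := mx_of_surj h; case/eqP: fh; rewrite -xh; apply: e0.
  by rewrite det_generic_unit xh.
- have [x xk] := mx_of_surj k; case/eqP: gk; rewrite -xk; apply: e0.
  by rewrite det_generic_unit xk.
Qed.

(** The eigenvalues are roots of unity of bounded order, so that the characteristic
polynomials take finitely many values. *)
Lemma irr_locus_det_sub_constant S c :
  S `<=` irr_locus F m n r.+1 -> zirreducible m n S ->
  (exists a, forall O AB, S O -> O AB -> \det (c%:M - AB.1) = a) /\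
  (exists b, forall O AB, S O -> O AB -> \det (c%:M - AB.2) = b).
Proof.
move=> Sirr irrS.
have SX := subset_trans Sirr (@irr_locus_char_variety _ _ _ _).
have eigen O AB : S O -> O AB -> exists omega (lam' mu' : 'rV[F]_r.+1),
    [/\ omega ^+ r.+1 = 1, forall i, lam' 0 i ^+ n = omega,
        forall i, mu' 0 i ^+ m = omega,
        \det (c%:M - AB.1) = \prod_i (c - lam' 0 i) &
        \det (c%:M - AB.2) = \prod_i (c - mu' 0 i)].
  move=> /Sirr[CD [rep irr ->]] [k uk ->].
  have [w [lam' [mu' [g [h [w1 ln mm [ug eA] [uh eB]]]]]]] :=
    irreducible_rep_eigenvalues m_gt0 n_gt0 rep irr.
  exists w, lam', mu'; split => //.
    by rewrite /= det_sub_conj // eA det_sub_conj // det_sub_diag.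
  by rewrite /= det_sub_conj // eB det_sub_conj // det_sub_diag.
have nr_gt0 : (0 < n * r.+1)%N by rewrite muln_gt0 n_gt0.
have [s _ ps] := XnsubC_split nr_gt0 (oner_neq0 F).
have mr_gt0 : (0 < m * r.+1)%N by rewrite muln_gt0 m_gt0.
have [t _ pt] := XnsubC_split mr_gt0 (oner_neq0 F).
have val1 O AB : S O -> O AB -> reg_eval (char_fun1 _ c) AB \in
    [seq \prod_i (c - s`_(f i)) | f : {ffun 'I_r.+1 -> 'I_(size s)}].
  move=> SO OAB; have [w [lam' [mu' [w1 ln _ e1 _]]]] := eigen O AB SO OAB.
  have [f lf] := root_list_index ps w1 ln; rewrite char_fun1E e1.
  by apply/mapP; exists f; rewrite ?mem_enum //; apply: eq_bigr => i _; rewrite lf.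
have val2 O AB : S O -> O AB -> reg_eval (char_fun2 _ c) AB \in
    [seq \prod_i (c - t`_(f i)) | f : {ffun 'I_r.+1 -> 'I_(size t)}].
  move=> SO OAB; have [w [lam' [mu' [w1 _ mm _ e2]]]] := eigen O AB SO OAB.
  have [f lf] := root_list_index pt w1 mm; rewrite char_fun2E e2.
  by apply/mapP; exists f; rewrite ?mem_enum //; apply: eq_bigr => i _; rewrite lf.
have [a _ fa] := zirreducible_constant SX (@char_fun1_invariant F m n r.+1 c) irrS val1.
have [b _ fb] := zirreducible_constant SX (@char_fun2_invariant F m n r.+1 c) irrS val2.
by split; [exists a | exists b] => O AB SO OAB;
  rewrite -(fa O AB, fb O AB) // (char_fun1E, char_fun2E).
Qed.

(** In an irreducible set that contains the stratum, all characteristic polynomials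
are those of D_lam and D_mu, and diagonalizable matrices with these are conjugate
to D_lam and D_mu. *)
Lemma stratum_component : irr_component m n (irr_locus F m n r.+1) stratum.
Proof.
split; [exact: stratum_irr_locus | exact: stratum_zirreducible |].
move=> S Sirr irrS subS; apply/seteqP; split=> // O SO.
have [AB [rep irr OE]] := Sirr O SO.
have [x /general_polyP gx] := mpoly_nonroot (general_poly_neq0 F r.+1).
have S1 := subS _ (stratum_general gx).
have OAB : O AB by rewrite OE; exact: conj_orbit_refl.
have [w [lam' [mu' [g [h [w1 ln mm [ug eA] [uh eB]]]]]]] :=
  irreducible_rep_eigenvalues m_gt0 n_gt0 rep irr.
have det1 c : \det (c%:M - AB.1) = \prod_i (c - lam 0 i).
  have [[a aP] _] := irr_locus_det_sub_constant c Sirr irrS.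
  by rewrite (aP _ _ SO OAB) -(aP _ _ S1 (conj_orbit_refl _)) det_sub_diag.
have det2 c : \det (c%:M - AB.2) = \prod_i (c - mu 0 i).
  have [_ [a aP]] := irr_locus_det_sub_constant c Sirr irrS.
  rewrite (aP _ _ SO OAB) -(aP _ _ S1 (conj_orbit_refl _)) /= det_sub_conj ?det_sub_diag //.
  by case: gx.
have [g' ug' eA'] := diagonal_form ug eA det1.
have [h' uh' eB'] := diagonal_form uh eB det2.
have AB_eq : AB = conj_pair g' (diag_pair (invmx g' *m h')).
  rewrite /conj_pair /= -eA' invmx_mul ?unitmx_inv // invmxK !mulmxA mulmxV // mul1mx.
  by rewrite -eB'; have := mulmxK ug'; case: (AB) => A B /= ->.
exists (invmx g' *m h'); rewrite unitmx_mul unitmx_inv ug'; split => //.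
  rewrite -(conj_pairK (diag_pair _) ug') -AB_eq.
  by apply: irreducible_conj => //; rewrite unitmx_inv.
by rewrite OE AB_eq conj_orbit_conj.
Qed.

(** A relation between the invariants on the parametrized pairs holds for h in
general position, and then for all h by density. *)
Lemma stratum_dim_le d (q : {mpoly F[d]}) (Psi : ('I_d -> F) -> mxpair F r.+1)
    (f : 'I_d.+1 -> regfun F r.+1) :
  (forall f, regular_on q (fun x => reg_eval f (Psi x))) ->
  (forall h, general_position h -> exists x g,
     [/\ q.@[x] != 0, g \in unitmx & diag_pair h = conj_pair g (Psi x)]) ->
  (forall i, invariant_fun m n (f i)) -> ~ alg_indep_on stratum f.
Proof.
move=> regPsi param If indep.
have [P P0 PPsi] := regular_dependence (fun i => regPsi (f i)).
case/eqP: P0; apply: indep => O AB [h [uh _ ->]] [k uk ->].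
have inv_f i : reg_eval (f i) (conj_pair k (diag_pair h)) = reg_eval (f i) (diag_pair h).
  by apply: If => //; exact: rep_diag_pair.
rewrite (meval_eq _ inv_f).
have [x xh] := mx_of_surj h; rewrite -xh.
apply: (regular_density (det_generic_neq0 _ _) (general_poly_neq0 _ _)
  (f := fun x => P.@[fun i => reg_eval (f i) (diag_pair (mx_of x))])).
- by apply: regular_meval => i; exact: regular_generic_pair.
- move=> y _ /general_polyP gy; have [z [g [qz ug yz]]] := param _ gy.
  rewrite -(PPsi z qz); apply: meval_eq => i; rewrite yz If //.
  rewrite -(conj_pairK (Psi z) ug) -yz; apply: rep_variety_conj; first by rewrite unitmx_inv.
  by apply: rep_diag_pair; case: gy.
- by rewrite det_generic_unit xh.
Qed.

(** The values of f cover a nonempty open set of the affine space, on which a nonzero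
polynomial cannot vanish. *)
Lemma stratum_alg_indep d (q : {mpoly F[d]}) (f : 'I_d -> regfun F r.+1) :
  q != 0 ->
  (forall x, q.@[x] != 0 -> exists h, [/\ h \in unitmx,
     irreducible_rep (diag_pair h) & forall i, reg_eval (f i) (diag_pair h) = x i]) ->
  alg_indep_on stratum f.
Proof.
move=> q0 fq P P0; apply/eqP; have : P * q == 0.
  apply/eqP/mpoly_eq0P => x; rewrite rmorphM /=.
  have [->|qx] := eqVneq q.@[x] 0; first by rewrite mulr0.
  have [h [uh irr fh]] := fq x qx.
  have SO : stratum (conj_orbit (diag_pair h)) by exists h.
  by rewrite -(meval_eq _ fh) (P0 _ _ SO (conj_orbit_refl _)) mul0r.
by rewrite mulf_eq0 (negPf q0) orbF.
Qed.

End Stratum.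

(** * Eigenvalues on the closure of the irreducible locus *)

Section ClosureEigenvalues.
Variables (F : numClosedFieldType) (m n r : nat).
Hypotheses (m_gt0 : (0 < m)%N) (n_gt0 : (0 < n)%N).

(** The irreducible locus is covered by the finitely many closed sets where both
characteristic polynomials are prescribed; those that contain no irreducible
representation can be left out. *)
Lemma zclosure_irr_locus_det_sub O AB :
  zclosure m n (irr_locus F m n r.+1) O -> O AB ->
  exists CD, [/\ rep_variety F m n r.+1 CD, irreducible_rep CD,
    forall c, \det (c%:M - AB.1) = \det (c%:M - CD.1) &
    forall c, \det (c%:M - AB.2) = \det (c%:M - CD.2)].
Proof.
move=> clO OAB.
have nr_gt0 : (0 < n * r.+1)%N by rewrite muln_gt0 n_gt0.
have [s _ ps] := XnsubC_split nr_gt0 (oner_neq0 F).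
have mr_gt0 : (0 < m * r.+1)%N by rewrite muln_gt0 m_gt0.
have [t _ pt] := XnsubC_split mr_gt0 (oner_neq0 F).
pose T : finType := ({ffun 'I_r.+1 -> 'I_(size s)} * {ffun 'I_r.+1 -> 'I_(size t)})%type.
pose p1 (e : T) c := \prod_i (c - s`_(e.1 i)).
pose p2 (e : T) c := \prod_i (c - t`_(e.2 i)).
pose good e (CD : mxpair F r.+1) := [/\ rep_variety F m n r.+1 CD, irreducible_rep CD,
  forall c, \det (c%:M - CD.1) = p1 e c & forall c, \det (c%:M - CD.2) = p2 e c].
(* The equations of the closed set indexed by e, with the equation 1 = 0 added when
   no irreducible representation has these eigenvalues. *)
pose I e : set (regfun F r.+1) := [set f |
  [\/ exists c, f = char_fun1 _ c - (p1 e c)%:MP, exists c, f = char_fun2 _ c - (p2 e c)%:MP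
    | f = 1%:MP /\ ~ exists CD, good e CD]].
have SX := @irr_locus_char_variety F r.+1 m n.
have invI e : I e `<=` @invariant_fun F m n r.+1.
  move=> f [[c ->]|[c ->]|[-> _]]; last exact: invariant_const.
    by apply: invariantB; [exact: char_fun1_invariant | exact: invariant_const].
  by apply: invariantB; [exact: char_fun2_invariant | exact: invariant_const].
have cover P : irr_locus F m n r.+1 P -> exists e, forall f, I e f -> vanishes_at f P.
  move=> [CD [rep irr ->]].
  have [w [lam [mu [g [h [w1 ln mm [ug e1] [uh e2]]]]]]] :=
    irreducible_rep_eigenvalues m_gt0 n_gt0 rep irr.
  have [f1 lf1] := root_list_index ps w1 ln; have [f2 lf2] := root_list_index pt w1 mm.
  have d1 c : \det (c%:M - CD.1) = p1 (f1, f2) c.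
    by rewrite e1 det_sub_conj // det_sub_diag; apply: eq_bigr => i _; rewrite lf1.
  have d2 c : \det (c%:M - CD.2) = p2 (f1, f2) c.
    by rewrite e2 det_sub_conj // det_sub_diag; apply: eq_bigr => i _; rewrite lf2.
  exists (f1, f2) => f If; apply: (vanishes_at_orbit (invI _ _ If) rep).
  case: If => [[c ->]|[c ->]|[_ []]]; last by exists CD.
    by rewrite /reg_eval mevalB mevalC -/(reg_eval _ _) char_fun1E d1 subrr.
  by rewrite /reg_eval mevalB mevalC -/(reg_eval _ _) char_fun2E d2 subrr.
have [e eP] := zclosure_finite_cover SX invI cover clO.
have [CD [rep irr d1 d2]] : exists CD, good e CD.
  apply: contrapT => bad; have /(_ AB OAB)/eqP := eP 1%:MP (Or33 _ _ (conj erefl bad)).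
  by rewrite /reg_eval mevalC oner_eq0.
exists CD; split=> // c.
  have := eP _ (Or31 _ _ (ex_intro _ c erefl)) AB OAB.
  by rewrite /reg_eval mevalB mevalC -/(reg_eval _ _) char_fun1E d1 => /eqP;
    rewrite subr_eq0 => /eqP.
have := eP _ (Or32 _ _ (ex_intro _ c erefl)) AB OAB.
by rewrite /reg_eval mevalB mevalC -/(reg_eval _ _) char_fun2E d2 => /eqP;
  rewrite subr_eq0 => /eqP.
Qed.

End ClosureEigenvalues.

(** * Dimensions of the families in rank three *)

Section GeneralIrreducible.
Variables (F : numClosedFieldType) (r : nat).
Implicit Types (lam mu : 'rV[F]_r.+1) (h : 'M[F]_r.+1).

Definition swap_pair s (AB : mxpair F s) : mxpair F s := (AB.2, AB.1).

Lemma irreducible_swap s (AB : mxpair F s) :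
  irreducible_rep AB -> irreducible_rep (swap_pair AB).
Proof. by move=> [s0 irr]; split=> // U [sA sB]; apply: irr. Qed.

(** Exchanging the generators amounts to replacing h by its inverse, so that results
on pairs with a repeated eigenvalue in the second matrix apply to the first. *)
Lemma diag_pair_swap lam mu h : h \in unitmx ->
  diag_pair lam mu h = conj_pair h (swap_pair (diag_pair mu lam (invmx h))).
Proof.
by move=> uh; rewrite /conj_pair /= invmxK !mulmxA mulmxV // mul1mx mulmxK.
Qed.

Lemma irreducible_diag_pair lam mu j h : injective (lam 0) -> simple_entry mu j ->
  h \in unitmx -> (forall i, h i j != 0) -> (forall i, invmx h j i != 0) ->
  irreducible_rep (diag_pair lam mu h).
Proof. by move=> linj mu_j uh; apply: irreducible_diag => //; rewrite mulVmx. Qed.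

Lemma irreducible_diag_pair_swap lam mu j h : simple_entry lam j -> injective (mu 0) ->
  h \in unitmx -> (forall i, h j i != 0) -> (forall i, invmx h i j != 0) ->
  irreducible_rep (diag_pair lam mu h).
Proof.
move=> lam_j minj uh h0 k0; rewrite diag_pair_swap //.
apply/(irreducible_conj uh)/irreducible_swap.
by apply: irreducible_diag_pair lam_j _ _ _; rewrite ?unitmx_inv ?invmxK.
Qed.

(** In suitable bases the projections are E_ii and h E_jj h^-1.  These traces are the
entries of a matrix all of whose rows and columns have sum 1. *)
Lemma trace_projectors lam mu i j h : h \in unitmx ->
  simple_entry lam i -> simple_entry mu j ->
  reg_eval (trace_fun r (lagrange_poly lam i) (lagrange_poly mu j)) (diag_pair lam mu h) =
  h i j * invmx h j i.
Proof.
move=> uh lam_i mu_j; rewrite trace_funE -!/(eigenprojector _ _ _) /=.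
rewrite eigenprojector_conj ?mulVmx //.
rewrite !eigenprojector_diag // -mulmx_deltaE; set M := (h *m _ *m _).
rewrite mxtrace_mulC -[_ *m delta_mx i i]mulmx1 /mxtrace (bigD1 i) //= mulmx_deltaE.
rewrite [X in _ * X + _]mxE eqxx mulr1 big1 ?addr0 // => k ki.
by rewrite mulmx_deltaE [X in _ * X]mxE eq_sym (negPf ki) mulr0.
Qed.

End GeneralIrreducible.

Section RankThreeStrata.
Variable F : numClosedFieldType.

Definition mx3 (R : Type) (a b c d e f g h i : R) : 'M[R]_3 :=
  \matrix_(j, k) tnth (tnth [tuple [tuple a; b; c]; [tuple d; e; f]; [tuple g; h; i]] j) k.

Lemma mulmx3 (R : pzRingType) (a b c d e f g h i a' b' c' d' e' f' g' h' i' : R) :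
  mx3 a b c d e f g h i *m mx3 a' b' c' d' e' f' g' h' i' =
  mx3 (a * a' + b * d' + c * g') (a * b' + b * e' + c * h') (a * c' + b * f' + c * i')
      (d * a' + e * d' + f * g') (d * b' + e * e' + f * h') (d * c' + e * f' + f * i')
      (g * a' + h * d' + i * g') (g * b' + h * e' + i * h') (g * c' + h * f' + i * i').
Proof.
apply/matrixP => -[j lj] [k lk]; rewrite !mxE !big_ord_recl big_ord0 !mxE addr0 addrA.
by case: j lj => [|[|[|//]]] ?; case: k lk => [|[|[|//]]] ?.
Qed.

Lemma mx3_1 (R : pzRingType) : mx3 1 0 0 0 1 0 0 0 (1 : R) = 1%:M.
Proof.
apply/matrixP => -[j lj] [k lk]; rewrite !mxE.
by case: j lj => [|[|[|//]]] ?; case: k lk => [|[|[|//]]] ?.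
Qed.

Lemma map_mx3 (R S : pzRingType) (phi : R -> S) a b c d e f g h i :
  map_mx phi (mx3 a b c d e f g h i) =
  mx3 (phi a) (phi b) (phi c) (phi d) (phi e) (phi f) (phi g) (phi h) (phi i).
Proof.
apply/matrixP => -[j lj] [k lk]; rewrite !mxE.
by case: j lj => [|[|[|//]]] ?; case: k lk => [|[|[|//]]] ?.
Qed.

Lemma forall_ord3 (P : 'I_3 -> Prop) : P 0 -> P 1 -> P ord_max -> forall i, P i.
Proof.
move=> P0 P1 P2 [[|[|[|//]]] lt].
- by rewrite [Ordinal _](_ : _ = 0) //; apply: val_inj.
- by rewrite [Ordinal _](_ : _ = 1) //; apply: val_inj.
- by rewrite [Ordinal _](_ : _ = ord_max) //; apply: val_inj.
Qed.

Lemma forall_ord2 (P : 'I_2 -> Prop) : P 0 -> P 1 -> forall i, P i.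
Proof.
move=> P0 P1 [[|[|//]] lt].
- by rewrite [Ordinal _](_ : _ = 0) //; apply: val_inj.
- by rewrite [Ordinal _](_ : _ = 1) //; apply: val_inj.
Qed.

Lemma sum_ord3 (V : nmodType) (f : 'I_3 -> V) : \sum_i f i = f 0 + f 1 + f ord_max.
Proof.
rewrite !big_ord_recl big_ord0 addr0 addrA; congr (f _ + f _ + f _); exact: val_inj.
Qed.

Lemma invmx_left r (H K : 'M[F]_r) : K *m H = 1%:M -> H \in unitmx /\ invmx H = K.
Proof.
move=> KH; have HK := mulmx1C KH; have [uH _] := mulmx1_unit HK; split=> //.
by apply: (can_inj (mulKmx uH)); rewrite mulmxV.
Qed.

(** An invertible matrix whose first column is p = (a, b, 1 - a - b) and such that the
first row of its inverse is (1, 1, 1): the other two columns span the vectors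
with coordinate sum zero.  Thus p (1, 1, 1) is the first spectral projection of
the conjugate of a diagonal matrix by it. *)
Definition barycentric_mx (R : pzRingType) (a b : R) :=
  mx3 a (-1) (-1) b 1 0 (1 - a - b) 0 1.

Lemma barycentric_mx_inv (a b : F) : barycentric_mx a b \in unitmx /\
  invmx (barycentric_mx a b) =
  mx3 1 1 1 (- b) (1 - b) (- b) (- (1 - a - b)) (- (1 - a - b)) (a + b).
Proof.
by apply: invmx_left; rewrite mulmx3 -mx3_1; congr mx3; ring.
Qed.

(** With u1 = (1, 1, 1), u2 = (a, b, 1) and columns v1 = p, v2 = q such that
u_i v_j = delta_ij, the cross products u1 x u2 and v1 x v2 complete the dual
bases; their scalar product is 1 by the Lagrange identity. *)
Lemma cross_product_inverse (p0 p1 p2 q0 q1 q2 a b : F) :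
  p0 + p1 + p2 = 1 -> q0 + q1 + q2 = 0 ->
  a * p0 + b * p1 + p2 = 0 -> a * q0 + b * q1 + q2 = 1 ->
  mx3 1 1 1 a b 1 (p1 * q2 - p2 * q1) (p2 * q0 - p0 * q2) (p0 * q1 - p1 * q0) *m
  mx3 p0 q0 (1 - b) p1 q1 (a - 1) p2 q2 (b - a) = 1%:M.
Proof.
move=> up uq vp vq; rewrite mulmx3 -mx3_1; congr mx3; try ring.
- by rewrite !mul1r.
- by rewrite !mul1r.
- by rewrite mul1r.
- by rewrite mul1r.
- transitivity ((p0 + p1 + p2) * (a * q0 + b * q1 + q2) -
                (q0 + q1 + q2) * (a * p0 + b * p1 + p2)); first by ring.
  by rewrite up uq vp vq; ring.
Qed.

Lemma quadratic_root (a b c : F) : a != 0 -> exists x, a * x ^+ 2 + b * x + c = 0.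
Proof.
move=> a0; have [x] := solve_monicpoly (fun i => if i is 0%N then - c / a else - b / a) (ltn0Sn 1).
rewrite !big_ord_recl big_ord0 /= expr0 mulr1 addr0 expr1 => xE; exists x.
by rewrite xE; field.
Qed.

(** The first row of h^-1 can be taken to be (1, 1, 1) and the second one (a, b, 1), so
that the prescribed traces force the first column of h to be s, and the second
column to be (t0 / a, t1 / b, t2).  The two orthogonality relations between these
rows and columns determine b in terms of a, and give a quadratic equation for a. *)
Lemma prescribed_projector_traces (s0 s1 s2 t0 t1 t2 : F) :
  s0 + s1 + s2 = 1 -> t0 + t1 + t2 = 1 ->
  s0 != 0 -> s1 != 0 -> s2 != 0 -> t0 != 0 -> t1 != 0 -> t2 != 0 ->
  exists h : 'M[F]_3, [/\ h \in unitmx,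
    [/\ h 0 0 * invmx h 0 0 = s0, h 1 0 * invmx h 0 1 = s1
      & h ord_max 0 * invmx h 0 ord_max = s2] &
    [/\ h 0 1 * invmx h 1 0 = t0, h 1 1 * invmx h 1 1 = t1
      & h ord_max 1 * invmx h 1 ord_max = t2]].
Proof.
move=> s_1 t_1 s00 s10 s20 t00 t10 t20.
(* The coefficients come from t0 b + t1 a + t2 a b = 0 by substituting b and
   multiplying by - s1. *)
have [a] := quadratic_root (t0 * s0 - t1 * s1 + t2 * s2) (t0 * s2) (mulf_neq0 t20 s00).
move=> a_eq; pose b := - (s2 + a * s0) / s1.
have bs : a * s0 + b * s1 + s2 = 0 by rewrite /b; field.
have ab_eq : t0 * b + t1 * a + t2 * a * b = 0.
  apply/(mulfI s10)/oppr_inj; rewrite mulr0 oppr0 -a_eq /b; field => //.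
have a0 : a != 0.
  apply/eqP => a0; move/eqP: a_eq; rewrite a0 !expr0n /= !mulr0 !add0r mulf_eq0.
  by rewrite (negPf t00) (negPf s20).
have b0 : b != 0.
  apply/eqP => b0; move/eqP: ab_eq; rewrite b0 !mulr0 add0r addr0 mulf_eq0.
  by rewrite (negPf t10) (negPf a0).
have q_0 : t0 / a + t1 / b + t2 = 0.
  apply/(mulfI a0)/(mulfI b0); rewrite !mulr0 -ab_eq; field; by rewrite a0 b0.
have q_1 : a * (t0 / a) + b * (t1 / b) + t2 = 1.
  by rewrite -t_1; field; rewrite a0 b0.
have [uh hK] := invmx_left (cross_product_inverse s_1 q_0 bs q_1).
eexists; split; first exact: uh.
  by rewrite hK !mxE /= !mulr1.
by rewrite hK !mxE /= mulr1 !divfK.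
Qed.

Lemma injective_simple (lam : 'rV[F]_3) i : injective (lam 0) -> simple_entry lam i.
Proof. by move=> linj k; apply: contra => /eqP/linj->. Qed.

(** Diagonal matrices commute with D_lam and with D_mu. *)
Lemma diag_pair_scale r (lam mu s t : 'rV[F]_r.+1) (h : 'M[F]_r.+1) :
  h \in unitmx -> (forall i, s 0 i != 0) -> (forall i, t 0 i != 0) ->
  diag_mx s \in unitmx /\
  diag_pair lam mu (diag_mx s *m h *m diag_mx t) = conj_pair (diag_mx s) (diag_pair lam mu h).
Proof.
move=> uh s0 t0; have udiag (d : 'rV[F]_r.+1) : (forall i, d 0 i != 0) -> diag_mx d \in unitmx.
  by move=> d0; rewrite unitmxE det_diag unitfE; apply/prodf_neq0 => i _.
have [us ut] := (udiag s s0, udiag t t0); split=> //.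
rewrite /diag_pair /conj_pair /= [diag_mx s *m diag_mx lam]diag_mxC mulmxK //.
congr (_, _); rewrite !invmx_mul ?unitmx_mul ?us //.
by rewrite !mulmxA -(mulmxA (diag_mx s *m h)) (diag_mxC t) !mulmxA mulmxK.
Qed.

(** A matrix in general position is rescaled on the left and on the right to one whose
first row and first column consist of 1. *)
Lemma distinct_dim_le m n (lam mu : 'rV[F]_3) (f : 'I_5 -> regfun F 3) :
  (exists omega, central_eigenvalues m n lam mu omega) ->
  (forall i, invariant_fun m n (f i)) -> ~ alg_indep_on (stratum lam mu) f.
Proof.
move=> central If.
pose G : 'M[{mpoly F[4]}]_3 := mx3 1 1 1 1 'X_0 'X_1 1 'X_2 'X_3.
apply: (stratum_dim_le central (regular_diag_pair lam mu G)) If => h [uh h0].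
pose R : 'M[F]_3 := \matrix_(i, j) (h i j * h 0 0 / (h i 0 * h 0 j)).
pose x : 'I_4 -> F :=
  tnth [tuple R 1 1; R 1 ord_max; R ord_max 1; R ord_max ord_max].
have GR : map_mx (meval x) G = R.
  have R0 j : R 0 j = 1.
    by rewrite mxE mulrC [h 0 0 * _]mulrC mulVf ?mulf_neq0 ?(h0 _ _).1.
  have R_0 i : R i 0 = 1 by rewrite mxE mulfV ?mulf_neq0 ?(h0 _ _).1.
  rewrite map_mx3 !meval1 !mevalXU; apply/matrixP.
  by apply: forall_ord3; apply: forall_ord3; rewrite ?R0 ?R_0 mxE.
pose s : 'rV[F]_3 := \row_i (h i 0 / h 0 0); pose t : 'rV[F]_3 := \row_j h 0 j.
have hR : h = diag_mx s *m R *m diag_mx t.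
  apply/matrixP => i j; rewrite mul_mx_diag mul_diag_mx !mxE.
  by field; rewrite !(h0 _ _).1.
have uR : R \in unitmx by move: (uh); rewrite hR !unitmx_mul => /andP[/andP[]].
have [||us eq_h] := @diag_pair_scale _ lam mu s t R uR.
- by move=> i; rewrite mxE mulf_neq0 ?invr_eq0 ?(h0 _ _).1.
- by move=> i; rewrite mxE ?(h0 _ _).1.
exists x, (diag_mx s); rewrite -det_map_mx GR -eq_h -hR; split=> //.
by rewrite -unitfE -unitmxE.
Qed.

(** The matrix of traces of products of projections is determined by its upper left
2 x 2 block, since its rows and columns have sum 1. *)
Definition corner_index (k : 'I_4) : 'I_3 * 'I_3 :=
  tnth [tuple (0, 0); (0, 1); (1, 0); (1, 1)] k.

(** All values of the four traces occur, as long as the entries of the first two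
columns of the matrix that they determine do not vanish. *)
Lemma distinct_alg_indep (lam mu : 'rV[F]_3) :
  injective (lam 0) -> injective (mu 0) ->
  alg_indep_on (stratum lam mu)
    (fun k => trace_fun 2 (lagrange_poly lam (corner_index k).1)
                          (lagrange_poly mu (corner_index k).2)).
Proof.
move=> linj minj.
pose q : {mpoly F[4]} := 'X_0 * 'X_1 * 'X_2 * 'X_3 * (1 - 'X_0 - 'X_2) * (1 - 'X_1 - 'X_3).
have qE x : q.@[x] = x 0 * x 1 * x 2 * x 3 * (1 - x 0 - x 2) * (1 - x 1 - x 3).
  by rewrite /q !(mevalM, mevalB, meval1, mevalXU).
apply: (@stratum_alg_indep _ _ _ _ _ q).
  apply/eqP => /(congr1 (meval (fun=> 3^-1))).
  rewrite qE meval0 => /eqP; rewrite !mulf_eq0 invr_eq0 !Num.Theory.pnatr_eq0 /=.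
  rewrite [1 - _ - _](_ : _ = 3^-1); last by field.
  by rewrite invr_eq0 Num.Theory.pnatr_eq0.
move=> x; rewrite qE !mulf_eq0 !negb_or.
move=> /andP[/andP[/andP[/andP[/andP[x0 x1] x2] x3] x02] x13].
have [||h [uh [s0 s1 s2] [t0 t1 t2]]] :=
  @prescribed_projector_traces (x 0) (x 2) (1 - x 0 - x 2) (x 1) (x 3) (1 - x 1 - x 3) _ _
    x0 x2 x02 x1 x3 x13; try ring.
exists h; split=> //.
  apply: (irreducible_diag_pair (j := 0) linj (injective_simple minj) uh).
    by apply: forall_ord3; apply: contraTneq isT => h00;
      [move: x0; rewrite -s0 | move: x2; rewrite -s1 | move: x02; rewrite -s2];
      rewrite h00 mul0r eqxx.
  by apply: forall_ord3; apply: contraTneq isT => h00;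
      [move: x0; rewrite -s0 | move: x2; rewrite -s1 | move: x02; rewrite -s2];
      rewrite h00 mulr0 eqxx.
move=> k; rewrite trace_projectors //; try exact: injective_simple.
by case: k => [[|[|[|[|//]]]] lk]; rewrite /corner_index /tnth /= ?s0 ?s1 ?t0 ?t1;
  congr x; apply: val_inj.
Qed.

Lemma distinct_has_dim m n (lam mu : 'rV[F]_3) :
  (exists omega, central_eigenvalues m n lam mu omega) ->
  injective (lam 0) -> injective (mu 0) -> has_dim m n (stratum lam mu) 4.
Proof.
move=> central linj minj; split; last by move=> f; exact: distinct_dim_le.
by eexists; split; [|exact: distinct_alg_indep] => k; exact: trace_fun_invariant.
Qed.

Lemma repeated_simple (mu : 'rV[F]_3) :
  mu 0 1 = mu 0 ord_max -> mu 0 0 != mu 0 1 -> simple_entry mu 0.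
Proof.
move=> m12 m01; apply: forall_ord3; rewrite ?eqxx // => _; rewrite eq_sym //.
by rewrite -m12.
Qed.

Lemma diag_mx_repeated (mu : 'rV[F]_3) : mu 0 1 = mu 0 ord_max ->
  diag_mx mu = (mu 0 1)%:M + (mu 0 0 - mu 0 1) *: delta_mx 0 0.
Proof.
move=> m12; apply/matrixP; apply: forall_ord3; apply: forall_ord3;
  rewrite !mxE /= ?mulr1n ?mulr0n ?mulr0 ?mulr1 ?addr0 //.
by rewrite addrC subrK.
Qed.

Lemma conj_diag_repeated (mu : 'rV[F]_3) (h : 'M[F]_3) i j :
  mu 0 1 = mu 0 ord_max -> h \in unitmx ->
  (h *m diag_mx mu *m invmx h) i j =
  mu 0 1 *+ (i == j) + (mu 0 0 - mu 0 1) * (h i 0 * invmx h 0 j).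
Proof.
move=> m12 uh; rewrite diag_mx_repeated // mulmxDr mulmxDl scalar_mxC mulmxK //.
by rewrite -scalemxAr -scalemxAl !mxE -mulmx_deltaE mxE.
Qed.

(** The second matrix is [mu 0 1] plus a multiple of the projection v u, where v is
the first column of h and u the first row of h^-1.  Conjugation by the diagonal
matrix of u turns u into (1, 1, 1) and v into the column with entries v_i u_i. *)
Lemma repeated_parametrization (lam mu : 'rV[F]_3) (h : 'M[F]_3) :
  mu 0 1 = mu 0 ord_max -> general_position h ->
  exists a b g, g \in unitmx /\
    diag_pair lam mu h = conj_pair g (diag_pair lam mu (barycentric_mx a b)).
Proof.
move=> m12 [uh h0]; pose K := invmx h; pose p i := h i 0 * K 0 i.
have sum_p : p 0 + p 1 + p ord_max = 1.
  have /matrixP/(_ 0 0) := mulVmx uh.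
  rewrite mxE sum_ord3 [RHS]mxE => e; rewrite -[RHS]e.
  by rewrite /p -/K !(mulrC (h _ _)).
pose t : 'rV[F]_3 := \row_i (K 0 i)^-1.
have ut : diag_mx t \in unitmx.
  rewrite unitmxE det_diag unitfE; apply/prodf_neq0 => i _.
  by rewrite mxE invr_eq0 (h0 _ _).2.
exists (p 0), (p 1), (diag_mx t); split=> //.
have [uH HK] := barycentric_mx_inv (p 0) (p 1).
rewrite /conj_pair /diag_pair /= diag_mxC mulmxK //; congr (_, _).
apply: (canRL (mulmxK ut)); apply/matrixP => i j.
rewrite (mul_mx_diag _ t) (mul_diag_mx t) mxE [RHS]mxE !conj_diag_repeated //.
rewrite HK ![t _ _]mxE.
have -> : barycentric_mx (p 0) (p 1) i 0 = p i.
  move: i; apply: forall_ord3; rewrite mxE //=.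
  by rewrite -[LHS]/(1 - p 0 - p 1) -sum_p; ring.
set K' := mx3 _ _ _ _ _ _ _ _ _; have -> : K' 0 j = 1.
  by move: j; apply: forall_ord3; rewrite mxE.
rewrite mulrDl mulrDr; congr (_ + _).
  by have [->|_] := eqVneq i j; rewrite ?mulr0n ?mul0r ?mulr0 // mulr1n mulrC.
by rewrite /p; field; rewrite !(h0 _ _).2.
Qed.

Definition barycentric_generic : 'M[{mpoly F[2]}]_3 := barycentric_mx 'X_0 'X_1.

Lemma meval_barycentric_generic x :
  map_mx (meval x) barycentric_generic = barycentric_mx (x 0) (x 1).
Proof. by rewrite map_mx3 !(mevalB, mevalN, meval1, meval0, mevalXU). Qed.

Lemma det_barycentric_generic x : (\det barycentric_generic).@[x] != 0.
Proof.
rewrite -det_map_mx meval_barycentric_generic -unitfE -unitmxE.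
by have [] := barycentric_mx_inv (x 0) (x 1).
Qed.

Lemma repeated_dim_le m n (lam mu : 'rV[F]_3) (f : 'I_3 -> regfun F 3) :
  (exists omega, central_eigenvalues m n lam mu omega) -> mu 0 1 = mu 0 ord_max ->
  (forall i, invariant_fun m n (f i)) -> ~ alg_indep_on (stratum lam mu) f.
Proof.
move=> central m12 If.
apply: (stratum_dim_le central (regular_diag_pair lam mu barycentric_generic)) If => h gh.
have [a [b [g [ug eq_h]]]] := repeated_parametrization lam m12 gh.
exists (fun i : 'I_2 => if i == 0 then a else b), g.
by rewrite det_barycentric_generic meval_barycentric_generic.
Qed.

Lemma repeated_dim_le_swap m n (lam mu : 'rV[F]_3) (f : 'I_3 -> regfun F 3) :
  (exists omega, central_eigenvalues m n lam mu omega) -> lam 0 1 = lam 0 ord_max ->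
  (forall i, invariant_fun m n (f i)) -> ~ alg_indep_on (stratum lam mu) f.
Proof.
move=> central l12 If.
have reg g : regular_on (\det barycentric_generic) (fun x => reg_eval g
    (swap_pair (diag_pair mu lam (map_mx (meval x) barycentric_generic)))).
  by apply: regular_reg_eval; [exact: regular_diag_pair2 | exact: regular_mx_const].
apply: (stratum_dim_le central reg) If => h [uh h0].
have [|a [b [g [ug eq_h]]]] := @repeated_parametrization mu lam (invmx h) l12.
  by split=> [|i j]; rewrite ?unitmx_inv // invmxK; case: (h0 i j).
exists (fun i : 'I_2 => if i == 0 then a else b), (h *m g).
rewrite det_barycentric_generic meval_barycentric_generic unitmx_mul uh conj_pairM //.
by split=> //; rewrite diag_pair_swap // eq_h.
Qed.

Definition barycentric_poly : {mpoly F[2]} := 'X_0 * 'X_1 * (1 - 'X_0 - 'X_1).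

Lemma barycentric_polyE x : barycentric_poly.@[x] = x 0 * x 1 * (1 - x 0 - x 1).
Proof. by rewrite /barycentric_poly !(mevalM, mevalB, meval1, mevalXU). Qed.

Lemma barycentric_poly_neq0 : barycentric_poly != 0.
Proof.
apply/eqP => /(congr1 (meval (fun=> 3^-1))).
rewrite barycentric_polyE meval0 [1 - _ - _](_ : _ = 3^-1); last by field.
by move/eqP; rewrite !mulf_eq0 invr_eq0 !Num.Theory.pnatr_eq0.
Qed.

Lemma barycentric_mx_neq0 (x : 'I_2 -> F) : barycentric_poly.@[x] != 0 ->
  (forall i, barycentric_mx (x 0) (x 1) i 0 != 0) /\
  (forall i, invmx (barycentric_mx (x 0) (x 1)) 0 i != 0).
Proof.
rewrite barycentric_polyE !mulf_eq0 !negb_or => /andP[/andP[x0 x1] x01].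
rewrite (barycentric_mx_inv _ _).2; split; apply: forall_ord3;
  by rewrite mxE // oner_neq0.
Qed.

(** The index of one of the first two barycentric coordinates; the third one is
determined by them. *)
Definition vertex (k : 'I_2) : 'I_3 := widen_ord (leqnSn 2) k.

Lemma barycentric_mx_vertex (x : 'I_2 -> F) k :
  barycentric_mx (x 0) (x 1) (vertex k) 0 *
    invmx (barycentric_mx (x 0) (x 1)) 0 (vertex k) = x k.
Proof.
by rewrite (barycentric_mx_inv _ _).2; move: k; apply: forall_ord2; rewrite !mxE /= mulr1.
Qed.

(** The two traces are the barycentric coordinates a and b of p. *)
Lemma repeated_alg_indep (lam mu : 'rV[F]_3) : injective (lam 0) -> simple_entry mu 0 ->
  alg_indep_on (stratum lam mu)
    (fun k => trace_fun 2 (lagrange_poly lam (vertex k)) (lagrange_poly mu 0)).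
Proof.
move=> linj mu_0; apply: (stratum_alg_indep barycentric_poly_neq0) => x.
move=> /barycentric_mx_neq0[h0 k0]; have [uh _] := barycentric_mx_inv (x 0) (x 1).
exists (barycentric_mx (x 0) (x 1)); split=> //.
  exact: irreducible_diag_pair linj mu_0 uh h0 k0.
move=> k; rewrite trace_projectors //; last exact: injective_simple.
exact: barycentric_mx_vertex.
Qed.

Lemma repeated_alg_indep_swap (lam mu : 'rV[F]_3) : simple_entry lam 0 -> injective (mu 0) ->
  alg_indep_on (stratum lam mu)
    (fun k => trace_fun 2 (lagrange_poly lam 0) (lagrange_poly mu (vertex k))).
Proof.
move=> lam_0 minj; apply: (stratum_alg_indep barycentric_poly_neq0) => x.
move=> /barycentric_mx_neq0[h0 k0]; have [uh _] := barycentric_mx_inv (x 0) (x 1).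
exists (invmx (barycentric_mx (x 0) (x 1))); rewrite unitmx_inv uh; split=> //.
  by apply: irreducible_diag_pair_swap lam_0 minj _ _ _; rewrite ?unitmx_inv ?invmxK.
move=> k; rewrite trace_projectors ?unitmx_inv //; last exact: injective_simple.
by rewrite invmxK mulrC barycentric_mx_vertex.
Qed.

Lemma repeated_has_dim m n (lam mu : 'rV[F]_3) :
  (exists omega, central_eigenvalues m n lam mu omega) -> injective (lam 0) ->
  mu 0 1 = mu 0 ord_max -> mu 0 0 != mu 0 1 -> has_dim m n (stratum lam mu) 2.
Proof.
move=> central linj m12 m01; split; last by move=> f; exact: repeated_dim_le.
eexists; split; last exact: repeated_alg_indep linj (repeated_simple m12 m01).
by move=> k; exact: trace_fun_invariant.
Qed.

Lemma repeated_has_dim_swap m n (lam mu : 'rV[F]_3) :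
  (exists omega, central_eigenvalues m n lam mu omega) -> injective (mu 0) ->
  lam 0 1 = lam 0 ord_max -> lam 0 0 != lam 0 1 -> has_dim m n (stratum lam mu) 2.
Proof.
move=> central minj l12 l01; split; last by move=> f; exact: repeated_dim_le_swap.
eexists; split; last exact: repeated_alg_indep_swap (repeated_simple l12 l01) minj.
by move=> k; exact: trace_fun_invariant.
Qed.

End RankThreeStrata.

(** * Root multiplicities of the twisted Alexander polynomial *)

Section TwistedAlexander.
Variable F : numClosedFieldType.

Lemma neq_inv (x : F) : x != 0 -> x != 1 -> x != -1 -> x != x^-1.
Proof.
move=> x0 x1 xN1; apply/eqP => xV; have : (x - 1) * (x + 1) == 0.
  by rewrite -subr_sqr expr1n expr2 {2}xV mulfV // subrr.
by rewrite mulf_eq0 subr_eq0 addr_eq0 (negPf x1) (negPf xN1).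
Qed.

Lemma pm1_inv (x : F) : x = 1 \/ x = -1 -> x^-1 = x.
Proof. by case=> ->; rewrite ?invrN invr1. Qed.

Lemma pm1_base_neq0 n (x : F) : (0 < n)%N -> x ^+ n = 1 \/ x ^+ n = -1 -> x != 0.
Proof.
move=> n0 xn; apply/eqP => x0; have : x ^+ n != 0.
  by case: xn => ->; rewrite ?oppr_eq0 oner_neq0.
by rewrite x0 expr0n eqn0Ngt n0 eqxx.
Qed.

(** Both factors divide the right-hand side since x ^ n = x^-1 ^ n, and they are
coprime since they differ by a nonzero constant. *)
Lemma Xn_factors_dvdp m n (x : F) : (0 < n)%N -> x ^+ n = 1 \/ x ^+ n = -1 ->
  x != 1 -> x != -1 ->
  ('X^m - x%:P) * ('X^m - (x^-1)%:P) %| 'X^(m * n) - (x ^+ n)%:P.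
Proof.
move=> n0 xn x1 xN1; have x0 := pm1_base_neq0 n0 xn.
have dvd y : 'X^m - y%:P %| 'X^(m * n) - (y ^+ n)%:P.
  by rewrite exprM polyC_exp subrXX dvdp_mulr.
rewrite Gauss_dvdp; last first.
  apply/Pdiv.ClosedField.coprimepP => y; rewrite !rootE !hornerE !subr_eq0 => /eqP ->.
  exact: neq_inv.
rewrite dvd -[x in (x ^+ n)%:P]invrK exprVn (pm1_inv (x := x^-1 ^+ n)) ?dvd //.
by rewrite exprVn pm1_inv.
Qed.

Section Multiplicity.
Variables (m n : nat) (eps veps : F).
Hypotheses (m_gt0 : (0 < m)%N) (n_gt0 : (0 < n)%N).
Hypotheses (eps_veps : eps ^+ n = veps ^+ m) (eps_pm1 : eps ^+ n = 1 \/ eps ^+ n = -1).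
Hypotheses (eps_neq : eps != 1 /\ eps != -1) (veps_neq : veps != 1 /\ veps != -1).

Let eps0 : eps != 0 := pm1_base_neq0 n_gt0 eps_pm1.
Let veps_pm1 : veps ^+ m = 1 \/ veps ^+ m = -1.
Proof. by rewrite -eps_veps. Qed.
Let veps0 : veps != 0 := pm1_base_neq0 m_gt0 veps_pm1.

Let Delta := twisted_alexander m n eps veps.
Let den := ('X^m - eps%:P) * ('X^m - (eps^-1)%:P) * ('X^n - veps%:P) * ('X^n - (veps^-1)%:P).

Lemma twisted_alexander_mul : Delta * den = ('X^(m * n) - (eps ^+ n)%:P) ^+ 2.
Proof.
apply: divpK; rewrite -mulrA expr2 dvdp_mul ?Xn_factors_dvdp ?eps_neq //;
  try by case: eps_neq.
by rewrite eps_veps mulnC Xn_factors_dvdp //; case: veps_neq.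
Qed.

Lemma twisted_alexander_neq0 : Delta != 0.
Proof.
have : Delta * den != 0 by rewrite twisted_alexander_mul expf_neq0 // XnsubC_neq0 ?muln_gt0 ?m_gt0.
by rewrite mulf_eq0 negb_or => /andP[].
Qed.

(** For w = u ^ 3 with u nonzero, this is the condition for two of the numbers u x, u / x and u ^ -2
to agree, when x is not its own inverse. *)
Definition is_repeated (x w : F) := (w == x) || (w == x^-1).

(** The numerator is the square of a polynomial with simple roots.  The denominator is
the product of a polynomial in X ^ m and a polynomial in X ^ n, each of which has
simple roots as well. *)
Lemma mup_twisted_alexander t :
  (mup t Delta + is_repeated eps (t ^+ m) + is_repeated veps (t ^+ n) =
   2 * (t ^+ (m * n) == eps ^+ n))%N.
Proof.
have sum_repeated x w : x != 0 -> x != 1 -> x != -1 ->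
    ((w == x) + (w == x^-1))%N = is_repeated x w.
  move=> x0 x1 xN1; rewrite /is_repeated; case: (eqVneq w x) => // ->.
  by rewrite (negPf (neq_inv _ _ _)).
rewrite -!sum_repeated ?eps0 ?veps0; try by [case: eps_neq | case: veps_neq].
have /(congr1 (mup t)) := twisted_alexander_mul.
rewrite /den expr2 !mupM ?mulf_neq0 ?twisted_alexander_neq0 ?XnsubC_neq0 ?muln_gt0 ?m_gt0 //.
rewrite !mup_XnsubC ?muln_gt0 ?m_gt0 ?invr_eq0 ?expf_neq0 // => e.
by rewrite mul2n -addnn -e !addnA.
Qed.

End Multiplicity.
End TwistedAlexander.

(** * Semisimplicity of a sum of an irreducible plane and a line *)

Section DirectSum.
Variable F : fieldType.

Lemma complement_of_rank r (U W : 'M[F]_r) :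
  (\rank U + \rank W = r)%N -> (U :&: W)%MS = 0 -> (U + W :=: 1%:M)%MS.
Proof.
move=> rUW UW0; have := mxrank_sum_cap U W; rewrite UW0 mxrank0 addn0 rUW => rk.
by apply/eqmxP; rewrite submx1 sub1mx /row_full rk eqxx.
Qed.

(** Let V be the plane and L the line.  An invariant subspace U meets V in 0 or in V.
In the first case U is 0 or a line, with complement everything or V; in the second
case U is V or everything, with complement L or 0. *)
Lemma irreducible_sum_semisimple (A B : 'M[F]_2) (a b u v : F) :
  irreducible_rep (A, B) -> a != 0 -> b != 0 ->
  semisimple_rep ((block_mx (a *: A) 0 0 (u%:M : 'M_1) : 'M_(2 + 1),
                   block_mx (b *: B) 0 0 (v%:M : 'M_1) : 'M_(2 + 1)) : mxpair F 3).
Proof.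
move=> [_ irr] a0 b0 U [/= sA sB].
pose V : 'M[F]_(2 + 1) := block_mx 1%:M 0 0 0; pose L : 'M[F]_(2 + 1) := block_mx 0 0 0 1%:M.
have rV : \rank V = 2%N by rewrite rank_diag_block_mx mxrank1 mxrank0.
have rL : \rank L = 1%N by rewrite rank_diag_block_mx mxrank1 mxrank0.
have sV (C : 'M[F]_2) (D : 'M[F]_1) : stablemx V (block_mx C 0 0 D : 'M_(2 + 1)).
  have -> : V *m block_mx C 0 0 D = block_mx C 0 0 D *m V.
    by rewrite !mulmx_block !(mul0mx, mulmx0, mul1mx, mulmx1, addr0).
  exact: submxMl.
have sL (C : 'M[F]_2) (D : 'M[F]_1) : stablemx L (block_mx C 0 0 D : 'M_(2 + 1)).
  have -> : L *m block_mx C 0 0 D = block_mx C 0 0 D *m L.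
    by rewrite !mulmx_block !(mul0mx, mulmx0, mul1mx, mulmx1, addr0, add0r).
  exact: submxMl.
(* K is the intersection of U and V, as a subspace of the plane. *)
pose W := (U :&: V)%MS; pose K := lsubmx (W : 'M[F]_(2 + 1)).
have WK : (W : 'M[F]_(2 + 1)) = row_mx K 0.
  have /submxP[X WX] : (W <= V)%MS by exact: capmxSr.
  rewrite -[LHS](@hsubmxK _ _ 2 1) -/K; congr row_mx.
  have XV : row_mx (lsubmx (X : 'M_(3, 2 + 1))) (rsubmx (X : 'M_(3, 2 + 1))) *m V =
      row_mx (lsubmx (X : 'M_(3, 2 + 1))) 0.
    by rewrite mul_row_block !mulmx0 !addr0 mulmx1.
  by rewrite hsubmxK in XV; rewrite WX XV row_mxKr.
have sK (C : 'M[F]_2) (c : F) (D : 'M[F]_1) : c != 0 ->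
    stablemx U (block_mx (c *: C) 0 0 D : 'M_(2 + 1)) -> stablemx <<K>>%MS C.
  move=> c0 sU.
  have /submxP[X] : (W *m (block_mx (c *: C) 0 0 D : 'M_(2 + 1)) <= W)%MS.
    rewrite sub_capmx (submx_trans _ sU) ?submxMr ?capmxSl //.
    by rewrite (submx_trans _ (sV (c *: C) D)) ?submxMr ?capmxSr.
  move=> WX; have e : row_mx K 0 *m block_mx (c *: C) 0 0 D = row_mx (K *m (c *: C)) 0.
    by rewrite mul_row_block !mulmx0 mul0mx !addr0.
  have /eq_row_mx[KC _] : row_mx (K *m (c *: C)) (0 : 'M_(2 + 1, 1)) =
      row_mx (X *m K) (X *m (0 : 'M_(2 + 1, 1))).
    by rewrite -e -mul_mx_row -WK; exact: WX.
  rewrite (eqmxMr _ (genmxE K)) genmxE.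
  by rewrite -[K *m C](scalerK c0) scalemxAr KC scalemx_sub ?submxMl.
have rW : \rank W = \rank <<K>>%MS by rewrite genmxE -(@rank_row_mx0 _ _ _ 1 K) -WK.
have [||rK] := irr <<K>>%MS.
- by split; [apply: sK a0 sA | apply: sK b0 sB].
- move=> rK; have W0 : W = 0 by apply/eqP; rewrite -mxrank_eq0 rW rK.
  have := mxrank_sum_cap U V; rewrite -/W W0 mxrank0 addn0 rV => rUV.
  have : (\rank U + 2 <= 3)%N by rewrite -rUV rank_leq_row.
  rewrite -[3%N]/(1 + 2)%N leq_add2r leq_eqVlt ltnS leqn0 => /orP[] /eqP rU.
    exists V; split=> //; first by split; apply: sV.
    by apply: complement_of_rank; rewrite ?rU ?rV.
  exists 1%:M; move/eqP: rU; rewrite mxrank_eq0 => /eqP->; split.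
  - by split; rewrite stableCmx.
  - exact: adds0mx.
  - exact: cap0mx.
have VU : (V <= U)%MS.
  have: (W <= V)%MS by exact: capmxSr.
  move/mxrank_leqif_sup => [_]; rewrite rW rK rV eqxx => /esym VW.
  by apply: submx_trans VW _; exact: capmxSl.
have : (2 <= \rank U <= 3)%N.
  by rewrite rank_leq_row andbT; have := mxrankS VU; rewrite rV.
rewrite andbC leq_eqVlt ltnS => /andP[/orP[/eqP rU _|rU2 rU1]].
  exists 0; split; first by split; rewrite stable0mx.
    by apply: complement_of_rank; rewrite ?mxrank0 ?addn0 // capmx0.
  exact: capmx0.
have rU : \rank U = 2%N by apply/eqP; rewrite eqn_leq rU2.
have UV : (U <= V)%MS by have [_] := mxrank_leqif_sup VU; rewrite rV rU eqxx => /esym.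
have UL0 : (U :&: L)%MS = 0.
  apply/eqP; rewrite -submx0 (submx_trans (capmxS UV (submx_refl L))) // submx0.
  have : (1%:M <= V + L)%MS.
    have -> : 1%:M = (V + L)%R :> 'M[F]_(2 + 1).
      by rewrite add_block_mx !addr0 !add0r -scalar_mx_block.
    by apply: addmx_sub_adds.
  rewrite sub1mx => /eqP rVL; have := mxrank_sum_cap V L; rewrite rVL rV rL.
  by move/eqP; rewrite -[X in _ == X]addn0 eqn_add2l mxrank_eq0.
exists L; split=> //; first by split; apply: sL.
by apply: complement_of_rank; rewrite ?rU ?rL.
Qed.

End DirectSum.

(** * Eigenvalues of the partially reducible representations *)

Section PartiallyReducible.
Variable F : numClosedFieldType.

Lemma eigenvalue_det_sub r (A : 'M[F]_r) a : eigenvalue A a = (\det (a%:M - A) == 0).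
Proof.
rewrite /eigenvalue /eigenspace kermx_eq0 row_free_unit unitmxE unitfE negbK.
by rewrite -opprB -scaleN1r detZ mulf_eq0 expf_eq0 oppr_eq0 oner_eq0 andbF.
Qed.

(** The case u = v is excluded because both x and y are roots. *)
Lemma two_roots (u v x y : F) : x != y ->
  (forall a, ((a - u) * (a - v) == 0) = pred2 x y a) ->
  (u = x /\ v = y) \/ (u = y /\ v = x).
Proof.
move=> xy roots; move: (roots x) (roots y) (roots u) (roots v).
rewrite /= !subrr mul0r mulr0 !eqxx orbT !mulf_eq0 !subr_eq0 /=.
move=> xuv yuv /esym/orP[]/eqP ux /esym/orP[]/eqP vx; subst u v; [|by left|by right|].
  by move: yuv; rewrite eq_sym (negPf xy).
by move: xuv; rewrite (negPf xy).
Qed.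

Definition triple (a b c : F) : 'rV[F]_3 := \row_i tnth [tuple a; b; c] i.

Lemma prod_triple (g : F -> F) a b c : \prod_i g (triple a b c 0 i) = g a * g b * g c.
Proof. by rewrite !big_ord_recl big_ord0 !mxE mulr1 mulrA. Qed.

Lemma triple_injective a b c : a != b -> a != c -> b != c -> injective (triple a b c 0).
Proof.
move=> ab ac bc; apply: forall_ord3; apply: forall_ord3; rewrite !mxE //= => /eqP;
  rewrite /tnth /= ?(negPf ab) ?(negPf ac) ?(negPf bc) // eq_sym;
  by rewrite ?(negPf ab) ?(negPf ac) ?(negPf bc).
Qed.

(** The order of the entries of e is arbitrary, so that a repeated eigenvalue can be
put in any two positions. *)
Lemma block_diagonal_form (A g : 'M[F]_2) (d : 'rV[F]_2) (w u x : F) (e : 'rV[F]_3) :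
  g \in unitmx -> A = g *m diag_mx d *m invmx g ->
  x != x^-1 -> eigenvalue A =1 pred2 x x^-1 ->
  (forall c, \prod_i (c - e 0 i) = (c - w * x) * (c - w / x) * (c - u)) ->
  exists2 h, h \in unitmx &
    (block_mx (w *: A) 0 0 (u%:M : 'M_1) : 'M_(2 + 1)) = h *m diag_mx e *m invmx h.
Proof.
move=> ug A_eq xV eigA eE.
pose G : 'M[F]_(2 + 1) := block_mx g 0 0 1%:M.
pose f : 'rV[F]_(2 + 1) := row_mx (w *: d) u%:M.
have uG : G \in unitmx by rewrite block_diag_mx_unit ug unitmx1.
have block_eq : (block_mx (w *: A) 0 0 (u%:M : 'M_1) : 'M_(2 + 1)) = G *m diag_mx f *m invmx G.
  rewrite invmx_block_diag // diag_mx_row /G !mulmx_block.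
  rewrite !(mulmx0, mul0mx, mul1mx, mulmx1, addr0, add0r) invmx1 mulmx1 A_eq.
  congr block_mx; first by rewrite linearZ /= -scalemxAr -scalemxAl.
  by rewrite -diag_const_mx; congr diag_mx; apply/rowP => i; rewrite !ord1 !mxE eqxx.
have d_xy : (d 0 0 = x /\ d 0 1 = x^-1) \/ (d 0 0 = x^-1 /\ d 0 1 = x).
  apply: two_roots => // a; rewrite -eigA eigenvalue_det_sub A_eq det_sub_conj //.
  by rewrite det_sub_diag !big_ord_recl big_ord0 mulr1 [lift _ _](_ : _ = 1) //; apply: val_inj.
have prod_f c : \prod_(i < 2 + 1) (c - f 0 i) = (c - w * x) * (c - w / x) * (c - u).
  rewrite big_split_ord /= big_ord1 row_mxEr [X in _ * (c - X)]mxE eqxx mulr1n; congr (_ * _).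
  rewrite !big_ord_recl big_ord0 mulr1 !row_mxEl [lift _ _](_ : _ = 1); last exact: val_inj.
  by rewrite !mxE; case: d_xy => -[-> ->]; rewrite // mulrC.
apply: (@diagonal_form _ 3 _ G f) => // c.
by rewrite block_eq det_sub_conj // det_sub_diag eE; exact: prod_f.
Qed.

Section Point.
Variables (m n : nat) (eps veps z : F) (AB : mxpair F 2).
Hypotheses (m_gt0 : (0 < m)%N) (n_gt0 : (0 < n)%N).
Hypotheses (eps_veps : eps ^+ n = veps ^+ m) (eps_pm1 : eps ^+ n = 1 \/ eps ^+ n = -1).
Hypotheses (eps_neq : eps != 1 /\ eps != -1) (veps_neq : veps != 1 /\ veps != -1).
Hypotheses (repAB : rep_variety F m n 2 AB) (irrAB : irreducible_rep AB).
Hypotheses (eig1 : eigenvalue AB.1 =1 pred2 eps eps^-1)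
           (eig2 : eigenvalue AB.2 =1 pred2 veps veps^-1).
Hypothesis z0 : z != 0.

Let eps0 : eps != 0 := pm1_base_neq0 n_gt0 eps_pm1.
Let veps_pm1 : veps ^+ m = 1 \/ veps ^+ m = -1.
Proof. by rewrite -eps_veps. Qed.
Let veps0 : veps != 0 := pm1_base_neq0 m_gt0 veps_pm1.
Let eps_inv : eps != eps^-1.
Proof. by case: eps_neq => *; exact: neq_inv. Qed.
Let veps_inv : veps != veps^-1.
Proof. by case: veps_neq => *; exact: neq_inv. Qed.

(** With w = z ^ m and x = eps, or w = z ^ n and x = veps, the characteristic
polynomial of the image of a generator under a partially reducible representation;
e lists its roots in some order. *)
Definition spectrum (w x : F) (e : 'rV[F]_3) :=
  forall c, \prod_i (c - e 0 i) = (c - w * x) * (c - w / x) * (c - w ^- 2).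

Lemma pr_rep_diagonal_form lam mu :
  spectrum (z ^+ m) eps lam -> spectrum (z ^+ n) veps mu ->
  exists g h, [/\ g \in unitmx, h \in unitmx & pr_rep m n AB z = conj_pair g (diag_pair lam mu h)].
Proof.
move=> sl sm; have [w [l' [m' [g [h [_ _ _ [ug e1] [uh e2]]]]]]] :=
  irreducible_rep_eigenvalues m_gt0 n_gt0 repAB irrAB.
have [G uG eG] := block_diagonal_form ug e1 eps_inv eig1 sl.
have [H uH eH] := block_diagonal_form uh e2 veps_inv eig2 sm.
exists G, (invmx G *m H); rewrite unitmx_mul unitmx_inv uG uH; split=> //.
rewrite /pr_rep /conj_pair /= invmx_mul ?unitmx_inv // invmxK !mulmxA mulmxV // mul1mx.
rewrite -eG -!exprM !(mulnC 2) in eH *; rewrite eH.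
by congr (_, _); rewrite mulmxK.
Qed.

Lemma pr_rep_semisimple : semisimple_rep (pr_rep m n AB z).
Proof.
by apply: irreducible_sum_semisimple; rewrite ?expf_neq0 // -surjective_pairing.
Qed.

End Point.

Lemma spectrum_mem w x lam i : spectrum w x lam ->
  [|| lam 0 i == w * x, lam 0 i == w / x | lam 0 i == w ^- 2].
Proof.
move=> sl; have /eqP := sl (lam 0 i); rewrite (bigD1 i) //= subrr mul0r eq_sym.
by rewrite !mulf_eq0 !subr_eq0 -orbA.
Qed.

Lemma spectrum_triple w x : spectrum w x (triple (w * x) (w / x) (w ^- 2)).
Proof. by move=> c; exact: (prod_triple (fun y => c - y)). Qed.

Lemma spectrum_distinct w x : w != 0 -> x != 0 -> x != x^-1 ->
  ~~ is_repeated x (w ^+ 3) -> injective (triple (w * x) (w / x) (w ^- 2) 0).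
Proof.
move=> w0 x0 xV; rewrite /is_repeated negb_or => /andP[wx wxV].
apply: triple_injective.
- by apply: contra xV => /eqP/(mulfI w0)/eqP.
- apply: contra wxV => /eqP e; apply/eqP/(mulIf x0); rewrite mulVf //.
  by rewrite exprSr -mulrA e mulfV ?expf_neq0.
- apply: contra wx => /eqP e; apply/eqP; rewrite exprSr.
  by rewrite -[w in X in _ * X = _](divfK x0) e mulrA mulfV ?mul1r ?expf_neq0.
Qed.

(** If w ^ 3 = x then w ^ -2 = w / x, and if w ^ 3 = 1 / x then w ^ -2 = w x.  The simple
eigenvalue is listed first. *)
Lemma spectrum_repeated w x : w != 0 -> x != 0 -> x != x^-1 ->
  is_repeated x (w ^+ 3) ->
  exists lam, [/\ spectrum w x lam, lam 0 1 = lam 0 ord_max & lam 0 0 != lam 0 1].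
Proof.
move=> w0 x0 xV; have w20 : w ^+ 2 != 0 by rewrite expf_neq0.
case/orP => /eqP w3.
  exists (triple (w * x) (w / x) (w ^- 2)); rewrite !mxE /tnth /=; split.
  - exact: spectrum_triple.
  - by apply: (mulfI w20); rewrite mulfV // mulrA -exprSr w3 mulfV.
  - by apply: contra xV => /eqP/(mulfI w0)/eqP.
exists (triple (w / x) (w * x) (w ^- 2)); rewrite !mxE /tnth /=; split.
- move=> c; rewrite (prod_triple (fun y => c - y)); congr (_ * _); exact: mulrC.
- by apply: (mulfI w20); rewrite mulfV // mulrA -exprSr w3 mulVf.
- by apply: contra xV => /eqP/(mulfI w0) ->.
Qed.

(** Let E = x ^ k, so that E ^ 2 = 1.  The three k-th powers are w ^ k E, w ^ k / E and
w ^ (-2 k), which agree when w ^ (3 k) = E. *)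
Lemma spectrum_power w x k lam : (0 < k)%N -> w != 0 ->
  x ^+ k = 1 \/ x ^+ k = -1 -> (w ^+ k) ^+ 3 = x ^+ k -> spectrum w x lam ->
  \prod_i lam 0 i = 1 /\ forall i, lam 0 i ^+ k = w ^+ k * x ^+ k.
Proof.
move=> k0 w0 xk wk sl; have x0 := pm1_base_neq0 k0 xk; split.
  have := sl 0; under eq_bigr => i _ do rewrite sub0r.
  rewrite prodrN card_ord !sub0r => e; apply: oppr_inj.
  rewrite -mulN1r -[X in X * _ = _](_ : (-1) ^+ 3 = -1); last by ring.
  by rewrite e; field; rewrite x0 w0.
move=> i; have E1 : x ^+ k * x ^+ k = 1 by case: xk => ->; rewrite ?mulrNN mulr1.
have wk0 : w ^+ k != 0 by rewrite expf_neq0.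
have /or3P[] := spectrum_mem i sl => /eqP ->.
- exact: exprMn.
- by rewrite exprMn exprVn pm1_inv.
- rewrite exprVn -exprM mulnC exprM; apply: (mulfI (expf_neq0 2 wk0)).
  by rewrite mulfV ?expf_neq0 // mulrA -exprSr wk.
Qed.

Section Locus.
Variables (m n : nat) (eps veps z : F).
Hypotheses (m_gt0 : (0 < m)%N) (n_gt0 : (0 < n)%N).
Hypotheses (eps_veps : eps ^+ n = veps ^+ m) (eps_pm1 : eps ^+ n = 1 \/ eps ^+ n = -1).
Hypotheses (eps_neq : eps != 1 /\ eps != -1) (veps_neq : veps != 1 /\ veps != -1).
Hypothesis z0 : z != 0.

Let eps0 : eps != 0 := pm1_base_neq0 n_gt0 eps_pm1.
Let veps_pm1 : veps ^+ m = 1 \/ veps ^+ m = -1.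
Proof. by rewrite -eps_veps. Qed.
Let veps0 : veps != 0 := pm1_base_neq0 m_gt0 veps_pm1.
Let eps_inv : eps != eps^-1.
Proof. by case: eps_neq => *; exact: neq_inv. Qed.
Let veps_inv : veps != veps^-1.
Proof. by case: veps_neq => *; exact: neq_inv. Qed.
Let zm0 : z ^+ m != 0. Proof. exact: expf_neq0. Qed.
Let zn0 : z ^+ n != 0. Proof. exact: expf_neq0. Qed.

Let Delta := twisted_alexander m n eps veps.
Let t := z ^+ 3.
Let rep1 := is_repeated eps ((z ^+ m) ^+ 3).
Let rep2 := is_repeated veps ((z ^+ n) ^+ 3).

Lemma mup_twisted_alexander_cube : (mup t Delta + rep1 + rep2 = 2 * (t ^+ (m * n) == eps ^+ n))%N.
Proof.
rewrite -(mup_twisted_alexander m_gt0 n_gt0 eps_veps eps_pm1 eps_neq veps_neq).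
by rewrite /rep1 /rep2 /t -!exprM ![(3 * _)%N]mulnC.
Qed.

Definition eigenvalue_data AB := [/\ rep_variety F m n 2 AB, irreducible_rep AB,
  eigenvalue AB.1 =1 pred2 eps eps^-1 & eigenvalue AB.2 =1 pred2 veps veps^-1].

(** In the closure, the eigenvalues are those of some irreducible representation.  So
their powers agree, which makes t a root of the numerator; it remains a root of
Delta since an irreducible representation has no repeated eigenvalues in both
generators. *)
Lemma closure_root AB : eigenvalue_data AB ->
  zclosure m n (irr_locus F m n 3) (conj_orbit (pr_rep m n AB z)) -> Delta.[t] = 0.
Proof.
move=> [repAB irrAB eig1 eig2] cl.
pose lam0 := triple (z ^+ m * eps) (z ^+ m / eps) ((z ^+ m) ^- 2).
have [CD [repCD irrCD d1 d2]] := zclosure_irr_locus_det_sub m_gt0 n_gt0 cl (conj_orbit_refl _).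
have [w [l' [m' [g [h [_ ln mm [ug e1] [uh e2]]]]]]] :=
  irreducible_rep_eigenvalues m_gt0 n_gt0 repCD irrCD.
have [g0 [h0 [ug0 uh0 prE]]] := pr_rep_diagonal_form m_gt0 n_gt0 eps_veps eps_pm1
  eps_neq veps_neq repAB irrAB eig1 eig2
  (spectrum_triple (z ^+ m) eps) (spectrum_triple (z ^+ n) veps).
have det1 lam c : spectrum (z ^+ m) eps lam -> \det (c%:M - CD.1) = \prod_i (c - lam 0 i).
  by move=> sl; rewrite -d1 prE det_sub_conj // det_sub_diag spectrum_triple sl.
have det2 mu c : spectrum (z ^+ n) veps mu -> \det (c%:M - CD.2) = \prod_i (c - mu 0 i).
  by move=> sl; rewrite -d2 prE det_sub_conj //= det_sub_conj // det_sub_diag spectrum_triple sl.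
have lam_n i : lam0 0 i ^+ n = w.
  have /eqP := det1 _ (lam0 0 i) (spectrum_triple _ _).
  rewrite [X in _ == X](bigD1 i) //= subrr mul0r.
  rewrite e1 det_sub_conj // det_sub_diag => /prodf_eq0[j _].
  by rewrite subr_eq0 => /eqP ->.
have tmn : t ^+ (m * n) == eps ^+ n.
  have := lam_n ord_max; rewrite -(lam_n 0) !mxE /tnth /= exprMn exprVn.
  set W := (z ^+ m) ^+ n => e; have W0 : W != 0 by rewrite expf_neq0.
  have -> : t ^+ (m * n) = W ^+ 3 by rewrite /t /W -!exprM -?mulnA mulnC -?mulnA.
  rewrite -(pm1_inv eps_pm1); apply/eqP; apply: (mulIf (expf_neq0 n eps0)).
  rewrite mulVf ?expf_neq0 // exprSr -mulrA -e.
  by rewrite [_ ^+ 2 ^+ n]exprAC -/W mulfV ?expf_neq0.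
apply/eqP; rewrite -[_ == 0]/(root Delta t); apply: contraT => /mupNroot m0.
have := mup_twisted_alexander_cube; rewrite m0 tmn add0n; case r1 : rep1; case r2 : rep2 => // _.
have [lam [sl l12 _]] := spectrum_repeated zm0 eps0 eps_inv r1.
have [mu [sm m12 _]] := spectrum_repeated zn0 veps0 veps_inv r2.
have [G uG eG] := diagonal_form ug e1 (fun c => det1 _ c sl).
have [H uH eH] := diagonal_form uh e2 (fun c => det2 _ c sm).
case: (@repeated_eigenvalues_reducible _ G H lam mu 1 ord_max 1 ord_max) => //.
by rewrite -eG -eH -surjective_pairing.
Qed.

(** Eigenvalues of the partially reducible representations with parameter z, in an order
for which generic conjugates generate an irreducible representation. *)
Definition adapted (lam mu : 'rV[F]_3) :=
  [/\ spectrum (z ^+ m) eps lam, spectrum (z ^+ n) veps mu &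
      forall h, general_position h -> irreducible_rep (diag_pair lam mu h)].

Hypothesis tmn : t ^+ (m * n) = eps ^+ n.

Lemma adapted_central lam mu : adapted lam mu ->
  exists omega, central_eigenvalues m n lam mu omega.
Proof.
move=> [sl sm _]; exists (z ^+ (m * n) * eps ^+ n).
have zmn : (z ^+ (m * n)) ^+ 3 = eps ^+ n by rewrite -tmn /t -!exprM mulnC.
have [|l1 ln] := spectrum_power n_gt0 zm0 eps_pm1 _ sl.
  by rewrite -[(z ^+ m) ^+ n]exprM zmn.
have [|m1 mm] := spectrum_power m_gt0 zn0 veps_pm1 _ sm.
  by rewrite -[(z ^+ n) ^+ m]exprM mulnC zmn.
by split=> // i; rewrite ?ln ?mm -exprM // mulnC eps_veps.
Qed.

Lemma adapted_closure lam mu AB : adapted lam mu -> eigenvalue_data AB ->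
  zclosure m n (stratum lam mu) (conj_orbit (pr_rep m n AB z)).
Proof.
move=> ad [repAB irrAB eig1 eig2]; have [sl sm irr] := ad.
have [g [h [ug uh prE]]] := pr_rep_diagonal_form m_gt0 n_gt0 eps_veps eps_pm1
  eps_neq veps_neq repAB irrAB eig1 eig2 sl sm.
rewrite prE; apply: (stratum_closure (adapted_central ad) irr) => //.
by rewrite -prE; apply: pr_rep_semisimple.
Qed.

Lemma adapted_distinct : ~~ rep1 -> ~~ rep2 ->
  exists lam mu, adapted lam mu /\ has_dim m n (stratum lam mu) 4.
Proof.
move=> r1 r2; have linj := spectrum_distinct zm0 eps0 eps_inv r1.
have minj := spectrum_distinct zn0 veps0 veps_inv r2.
exists (triple (z ^+ m * eps) (z ^+ m / eps) ((z ^+ m) ^- 2)).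
exists (triple (z ^+ n * veps) (z ^+ n / veps) ((z ^+ n) ^- 2)).
set lam := triple _ _ _ in linj *; set mu := triple _ _ _ in minj *.
have ad : adapted lam mu.
  split; try exact: spectrum_triple.
  move=> h [uh h0]; apply: (irreducible_diag_pair (j := 0) linj (injective_simple minj)) => // i;
    by case: (h0 i 0); case: (h0 0 i).
by split=> //; apply: distinct_has_dim => //; exact: adapted_central.
Qed.

Lemma adapted_repeated : rep1 (+) rep2 ->
  exists lam mu, adapted lam mu /\ has_dim m n (stratum lam mu) 2.
Proof.
case r1 : rep1; case r2 : rep2 => // _.
  have minj := spectrum_distinct zn0 veps0 veps_inv (negbT r2).
  have [lam [sl l12 l01]] := spectrum_repeated zm0 eps0 eps_inv r1.
  exists lam, (triple (z ^+ n * veps) (z ^+ n / veps) ((z ^+ n) ^- 2)).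
  set mu := triple _ _ _ in minj *.
  have ad : adapted lam mu.
    split; [by [] | exact: spectrum_triple|].
    move=> h [uh h0]; apply: (irreducible_diag_pair_swap (repeated_simple l12 l01)) => // i;
      by case: (h0 i 0); case: (h0 0 i).
  by split=> //; apply: repeated_has_dim_swap => //; exact: adapted_central.
have linj := spectrum_distinct zm0 eps0 eps_inv (negbT r1).
have [mu [sm m12 m01]] := spectrum_repeated zn0 veps0 veps_inv r2.
exists (triple (z ^+ m * eps) (z ^+ m / eps) ((z ^+ m) ^- 2)), mu.
set lam := triple _ _ _ in linj *.
have ad : adapted lam mu.
  split; [exact: spectrum_triple | by [] |].
  move=> h [uh h0]; apply: (irreducible_diag_pair linj (repeated_simple m12 m01)) => // i;
    by case: (h0 i 0); case: (h0 0 i).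
by split=> //; apply: repeated_has_dim => //; exact: adapted_central.
Qed.

End Locus.

(** The multiplicity d is 2 minus the number of generators with a repeated eigenvalue,
and the dimension of the stratum with these eigenvalues is 4 or 2 accordingly. *)
Lemma component_closure m n eps veps z d :
  (0 < m)%N -> (0 < n)%N -> eps ^+ n = veps ^+ m -> eps ^+ n = 1 \/ eps ^+ n = -1 ->
  eps != 1 /\ eps != -1 -> veps != 1 /\ veps != -1 -> z != 0 ->
  (0 < d)%N -> mup (z ^+ 3) (twisted_alexander m n eps veps) = d ->
  exists S, [/\ irr_component m n (irr_locus F m n 3) S, has_dim m n S (2 * d) &
    forall AB, eigenvalue_data m n eps veps AB ->
      zclosure m n S (conj_orbit (pr_rep m n AB z))].
Proof.
move=> m0 n0 ev e1 en vn z0 d0 md.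
have := mup_twisted_alexander_cube z m0 n0 ev e1 en vn; rewrite md.
case: eqP => [tmn e|_ /eqP]; last by rewrite muln0 -addnA addn_eq0 eqn0Ngt d0.
suff [lam [mu [ad hd]]] : exists lam mu, adapted m n eps veps z lam mu /\
    has_dim m n (stratum lam mu) (2 * d).
  exists (stratum lam mu); split=> //.
    apply: stratum_component => //; first exact: (adapted_central m0 n0 ev e1 z0 tmn ad).
    by case: ad.
  by move=> AB; apply: adapted_closure.
move: e; case r1 : (is_repeated eps _); case r2 : (is_repeated veps _); rewrite ?addn0 ?addn1 => e.
- by case: d d0 e {md} => // d _ [].
- have -> : d = 1%N by case: e.
  by apply: adapted_repeated => //; rewrite r1 r2.
- have -> : d = 1%N by case: e.
  by apply: adapted_repeated => //; rewrite r1 r2.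
- by rewrite e; apply: adapted_distinct => //; rewrite ?r1 ?r2.
Qed.

End PartiallyReducible.

Theorem proposition9p4 (R : realType) (m n : nat)
    (m_gt0 : (0 < m)%N) (n_gt0 : (0 < n)%N) (co_mn : coprime m n)
    (eps veps : R[i])
    (eps_veps : eps ^+ n = veps ^+ m)
    (eps_pm1 : eps ^+ n = 1 \/ eps ^+ n = -1)
    (eps_neq : eps != 1 /\ eps != -1)
    (veps_neq : veps != 1 /\ veps != -1)
    (Y : set (set (mxpair R[i] 2)))
    (Y_comp : irr_component m n (irr_locus R[i] m n 2) Y)
    (Y_eig : forall P AB, Y P -> P AB ->
       eigenvalue AB.1 =1 pred2 eps eps^-1 /\
       eigenvalue AB.2 =1 pred2 veps veps^-1) :
  let Delta := twisted_alexander m n eps veps in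
  pr_component m n Y `&` zclosure m n (irr_locus R[i] m n 3) =
    \bigcup_(z in [set z : R[i] | z != 0 /\ Delta.[z ^+ 3] = 0]) pr_curve m n Y z
  /\
  forall z0 : R[i], z0 != 0 ->
    (mup (z0 ^+ 3) Delta = 2%N ->
       exists S, [/\ irr_component m n (irr_locus R[i] m n 3) S, has_dim m n S 4
                   & pr_curve m n Y z0 `<=` zclosure m n S]) /\
    (mup (z0 ^+ 3) Delta = 1%N ->
       exists S, [/\ irr_component m n (irr_locus R[i] m n 3) S, has_dim m n S 2
                   & pr_curve m n Y z0 `<=` zclosure m n S]).
Proof.
move=> Delta.
have data P AB : Y P -> P AB -> @eigenvalue_data R[i] m n eps veps AB.
  move=> YP PAB; have [e1 e2] := Y_eig P AB YP PAB; split=> //.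
    have [sub _ _] := Y_comp; have [CD [rep _ PE]] := sub P YP.
    by move: PAB; rewrite PE => -[g ug ->]; exact: rep_variety_conj.
  have [sub _ _] := Y_comp; have [CD [_ irr PE]] := sub P YP.
  by move: PAB; rewrite PE => -[g ug ->]; exact: irreducible_conj.
have component z0 d : z0 != 0 -> (0 < d)%N -> mup (z0 ^+ 3) Delta = d ->
    exists S, [/\ irr_component m n (irr_locus R[i] m n 3) S, has_dim m n S (2 * d)
                & pr_curve m n Y z0 `<=` zclosure m n S].
  move=> z00 d0 md.
  have [S [compS dimS clS]] := component_closure m_gt0 n_gt0 eps_veps eps_pm1
    eps_neq veps_neq z00 d0 md.
  by exists S; split=> // O [P [AB [YP PAB ->]]]; apply: clS; exact: data YP PAB.
split; last by move=> z0 z00; split; exact: component.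
apply/seteqP; split=> O.
  move=> [[z z0 [P [AB [YP PAB OE]]]] clO]; exists z; last by exists P, AB.
  split=> //; apply: (closure_root m_gt0 n_gt0 eps_veps eps_pm1 eps_neq veps_neq z0
    (data P AB YP PAB)).
  by rewrite -OE.
move=> [z [z0 Dz] curve]; split; first by exists z.
have m_pos : (0 < mup (z ^+ 3) Delta)%N.
  by rewrite -XsubC_dvd ?dvdp_XsubCl ?rootE ?Dz // twisted_alexander_neq0.
have [S [[subS _ _] _ curveS]] := component z _ z0 m_pos erefl.
exact: (zclosure_subset subS) (curveS O curve).
Qed.
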